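(* Let $(X,U)\in\mathbb R^p\times\mathbb R^k$ ($k\ge1$) have a spherically symmetric distribution around $(\theta,0)$, where $\theta\in\mathbb R^p$ is unknown. Let $g:\mathbb R^p\to\mathbb R^p$ be weakly differentiable, and consider the estimator of $\theta$ $$\varphi_g(X,U)=X+\|U\|^2g(X),$$ with loss $\|\varphi_g(X,U)-\theta\|^2$, together with the unbiased estimator of this loss $$\delta_0^g(X,U)=\frac pk\|U\|^2+\left(\|g(X)\|^2+\frac{2}{k+2}\operatorname{div}g(X)\right)\|U\|^4 .$$ For a nonnegative function $\gamma$ on $\mathbb R^p$, let $$\delta^g_\gamma(X,U)=\delta_0^g(X,U)-\|U\|^4\gamma(X).$$ Assume that $p\ge5$, that the distribution of $(X,U)$ has a finite fourth moment, that $\gamma$ is twice weakly differentiable on $\mathbb R^p$, and that there exists a constant $\beta$ such that $\gamma(t)\le\beta/\|t\|^2$ (for $t\neq0$). Then a sufficient condition under which $\delta^g_\gamma$ dominates the unbiased estimator $\delta_0^g$ is that $\gamma$ satisfies the differential inequality $$\gamma^2-\frac{4}{k+2}\,\gamma\operatorname{div}g+\frac{4}{k+6}\operatorname{div}(\gamma g)+\frac{2}{(k+4)(k+6)}\Delta\gamma\le0 .$$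
   Context: A random vector $Y\in\mathbb R^n$ is spherically symmetric around $\mu\in\mathbb R^n$ if $Y\overset{d}{=}\mu+R\,V$ with $R\ge0$ a random radius independent of $V$, and $V$ uniform on the unit sphere of $\mathbb R^n$; here $n=p+k$ and $\mu=(\theta,0)$. $E_\theta$ is the corresponding expectation. The estimator $\varphi_g$ is assumed to have finite quadratic risk $E_\theta[\|\varphi_g(X,U)-\theta\|^2]$. The risk of a loss estimator $\delta(X,U)$ is $\mathcal R(\theta,\varphi_g,\delta)=E_\theta[(\delta(X,U)-\|\varphi_g(X,U)-\theta\|^2)^2]$. A loss estimator $\delta$ dominates $\delta_0$ if $\mathcal R(\theta,\varphi_g,\delta)\le\mathcal R(\theta,\varphi_g,\delta_0)$ for all $\theta\in\mathbb R^p$, with strict inequality for some $\theta$. Unbiasedness of $\delta_0^g$ means $E_\theta[\delta_0^g(X,U)]=E_\theta[\|\varphi_g(X,U)-\theta\|^2]$ for all $\theta$. Derivatives are weak: a locally integrable function is weakly differentiable if it has locally integrable distributional first-order partial derivatives, and twice weakly differentiable if these are again weakly differentiable; $\operatorname{div}$ and $\Delta$ (the Laplacian) are taken in this sense.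
   Formalization: The risk inequality holds for all θ; strict inequality at some θ (false e.g. for γ = 0) is claimed only if at some θ the unbiased estimator δ_0^g has finite risk and δ_γ^g differs from δ_0^g with positive probability. *)

(* Defs.v *)
From HB Require Import structures.
From mathcomp Require Import all_boot all_order all_algebra.
From mathcomp Require Import all_classical all_reals all_analysis.

Set Implicit Arguments.
Unset Strict Implicit.
Unset Printing Implicit Defensive.

Import Order.TTheory GRing.Theory Num.Theory.
Import numFieldNormedType.Exports.

Local Open Scope classical_set_scope.
Local Open Scope ring_scope.

(* The sigma-algebra generated by the coordinates, i.e. the Borel one. *)
Section measurable_rV.
Context {R : realType}.
Variable n : nat.

Let coord (i : 'I_n) (x : 'rV[R]_n) : R := x 0 i.

Let rV_set0 : g_sigma_preimage coord set0.
Proof. exact: sigma_algebra0. Qed.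

Let rV_setC A : g_sigma_preimage coord A -> g_sigma_preimage coord (~` A).
Proof. exact: sigma_algebraC. Qed.

Let rV_bigcup (F : (set 'rV[R]_n)^nat) :
  (forall i, g_sigma_preimage coord (F i)) ->
  g_sigma_preimage coord (\bigcup_i (F i)).
Proof. exact: sigma_algebra_bigcup. Qed.

HB.instance Definition _ := @isMeasurable.Build default_measure_display
  'rV[R]_n (g_sigma_preimage coord) rV_set0 rV_setC rV_bigcup.

End measurable_rV.

Lemma measurable_coord (R : realType) n (i : 'I_n) :
  measurable_fun [set: 'rV[R]_n] (fun x : 'rV[R]_n => x 0 i).
Proof.
move=> _ Y mY; rewrite setTI; apply: sub_sigma_algebra => /=.
rewrite -bigcup_seq/=; exists i => /=; first by rewrite mem_index_enum.
by exists Y => //; rewrite setTI.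
Qed.

Lemma measurable_fun_rVP d (T : measurableType d) (R : realType) n
    (f : T -> 'rV[R]_n) :
  (forall i, measurable_fun [set: T] (fun t => f t 0 i)) ->
  measurable_fun [set: T] f.
Proof.
move=> mf _ Y mY; rewrite setTI.
have : g_sigma_preimage (fun i t => f t 0 i) `<=` measurable.
  apply: smallest_sub; first exact: sigma_algebra_measurable.
  case: n => [|n] in f mf Y mY *; first by rewrite big_ord0.
  rewrite -bigcup_mkord_ord; apply: bigcup_sub => i Ii.
  by move=> A [B mB <-]; exact: mf.
apply.
rewrite (_ : (fun i t => f t 0 i) = (fun i => (fun x : 'rV[R]_n => x 0 i) \o f))//.
by rewrite (@g_sigma_preimage_comp _ R n 'rV[R]_n); exists Y; rewrite // setTI.
Qed.

Section lebesgue_rV.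
Context {R : realType}.
Local Open Scope ereal_scope.

Definition rV_cons n (z : R * 'rV[R]_n) : 'rV[R]_n.+1 :=
  \row_i (if unlift ord0 i is Some j then z.2 0%R j else z.1).

Definition rV_uncons n (x : 'rV[R]_n.+1) : R * 'rV[R]_n :=
  (x 0%R ord0, \row_j x 0%R (lift ord0 j)).

Lemma rV_consK n : cancel (@rV_cons n) (@rV_uncons n).
Proof.
move=> [r v]; rewrite /rV_uncons !mxE unlift_none; congr pair.
by apply/rowP => j; rewrite !mxE liftK.
Qed.

Lemma measurable_rV_cons n : measurable_fun setT (@rV_cons n).
Proof.
apply: measurable_fun_rVP => i.
under eq_fun do rewrite mxE.
case: unliftP => [j _|_]; last exact: measurable_fst.
apply: (measurableT_comp (@measurable_coord R n j)); exact: measurable_snd.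
Qed.

Lemma measurable_rV_uncons n : measurable_fun setT (@rV_uncons n).
Proof.
apply/measurable_fun_pairP; split.
  exact: (@measurable_coord R n.+1 ord0).
apply: measurable_fun_rVP => j.
under eq_fun do rewrite mxE.
exact: measurable_coord.
Qed.

Section step.
Variables (n : nat) (mu : {sigma_finite_measure set 'rV[R]_n -> \bar R}).

Definition lebesgue_rV_step : set 'rV[R]_n.+1 -> \bar R :=
  pushforward (@lebesgue_measure R \x mu) (@rV_cons n).

Let step0 : lebesgue_rV_step set0 = 0.
Proof. by rewrite /lebesgue_rV_step /pushforward preimage_set0 measure0. Qed.

Let step_ge0 A : 0 <= lebesgue_rV_step A.
Proof. by rewrite /lebesgue_rV_step /pushforward; exact: measure_ge0. Qed.

Let step_sigma_additive : semi_sigma_additive lebesgue_rV_step.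
Proof.
move=> F mF tF mUF; rewrite /lebesgue_rV_step /pushforward preimage_bigcup.
apply: measure_semi_sigma_additive.
- by move=> i; rewrite -[X in measurable X]setTI; exact: measurable_rV_cons.
- apply/trivIsetP => /= i j _ _ ij; rewrite -preimage_setI.
  by move/trivIsetP : tF => /(_ _ _ _ _ ij) ->//; rewrite preimage_set0.
- rewrite -preimage_bigcup -[X in measurable X]setTI.
  exact: measurable_rV_cons.
Qed.

HB.instance Definition _ := isMeasure.Build _ _ _ lebesgue_rV_step
  step0 step_ge0 step_sigma_additive.

Let step_sigma_finite : sigma_finite setT lebesgue_rV_step.
Proof.
have /sigma_finiteP [F [FT ndF mF]] := sigma_finiteT (@lebesgue_measure R).
have /sigma_finiteP [G [GT ndG mG]] := sigma_finiteT mu.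
exists (fun i => @rV_uncons n @^-1` (F i `*` G i)).
  apply/seteqP; split => // x _.
  have [i _ Fi] : (\bigcup_i F i) (rV_uncons x).1 by rewrite -FT.
  have [j _ Gj] : (\bigcup_i G i) (rV_uncons x).2 by rewrite -GT.
  exists (maxn i j) => //; split.
  - by have /subsetPset := ndF _ _ (leq_maxl i j); exact.
  - by have /subsetPset := ndG _ _ (leq_maxr i j); exact.
move=> i; have [mFi Fioo] := mF i; have [mGi Gioo] := mG i.
split.
  rewrite -[X in measurable X]setTI; apply: measurable_rV_uncons => //.
  exact: measurableX.
rewrite /lebesgue_rV_step /pushforward -comp_preimage.
rewrite (_ : _ \o _ = id); last by apply/funext => z; exact: rV_consK.
rewrite preimage_id.
rewrite product_measure1E//; apply: lte_mul_pinfty => //.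
by rewrite ge0_fin_numE.
Qed.

HB.instance Definition _ := @Measure_isSigmaFinite.Build _ _ _
  lebesgue_rV_step step_sigma_finite.

End step.

Fixpoint lebesgue_rV n : {sigma_finite_measure set 'rV[R]_n -> \bar R} :=
  match n with
  | 0 => \d_(0%R : 'rV[R]_0)
  | m.+1 => lebesgue_rV_step (lebesgue_rV m)
  end.

Lemma measurable_rV_box n (A : 'I_n -> set R) :
  (forall i, measurable (A i)) ->
  measurable [set x : 'rV[R]_n | forall i, A i (x 0%R i)].
Proof.
move=> mA.
have -> : [set x : 'rV[R]_n | forall i, A i (x 0%R i)] =
    \bigcap_(i in [set: 'I_n]) [set x : 'rV[R]_n | A i (x 0%R i)].
  by apply/seteqP; split => x xA i; [move=> _; exact: xA|exact: xA].
apply: fin_bigcap_measurable; first exact: finite_finset.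
move=> i _; rewrite -[X in measurable X]setTI.
exact: (@measurable_coord R n i).
Qed.

Lemma lebesgue_rV_box n (A : 'I_n -> set R) :
  (forall i, measurable (A i)) ->
  lebesgue_rV n [set x : 'rV[R]_n | forall i, A i (x 0%R i)] =
  \prod_(i < n) lebesgue_measure (A i).
Proof.
elim: n A => [|n IHn] A mA.
  rewrite big_ord0 /= diracE mem_set// => i; by case: i.
rewrite big_ord_recl /= /lebesgue_rV_step /pushforward.
rewrite (_ : _ @^-1` _ =
    A ord0 `*` [set v : 'rV[R]_n | forall i, A (lift ord0 i) (v 0%R i)]).
  rewrite product_measure1E; [|exact: mA|].
    by congr (_ * _); exact: (IHn _ (fun i => mA (lift ord0 i))).
  exact: (measurable_rV_box (fun i => mA (lift ord0 i))).
apply/seteqP; split => -[r v] /= => [zA|[rA vA] i].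
  split; first by have := zA ord0; rewrite mxE unlift_none.
  by move=> i; have := zA (lift ord0 i); rewrite mxE liftK.
by rewrite mxE; case: unliftP => [j ->|->].
Qed.

End lebesgue_rV.

Section euclidean.
Context {R : realType} {n : nat}.
Implicit Types x y : 'rV[R]_n.

(* The library's norm on row vectors is the sup norm. *)
Definition dotv x y : R := \sum_i x 0 i * y 0 i.

Definition sqnormv x : R := dotv x x.

Definition enorm x : R := Num.sqrt (sqnormv x).

End euclidean.

Section weak_derivatives.
Context {R : realType} {p : nat}.
Implicit Types (f h phi : 'rV[R]_p -> R) (F : 'rV[R]_p -> 'rV[R]_p).

Local Notation mu := (@lebesgue_rV R p).

Definition partial (i : 'I_p) f : 'rV[R]_p -> R :=
  fun x => 'D_(delta_mx 0 i) f x.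

Definition iter_partial (s : seq 'I_p) f := foldr partial f s.

Definition smooth f := forall s : seq 'I_p,
  continuous (iter_partial s f) /\
  forall x i, derivable (iter_partial s f) x (delta_mx 0 i).

Definition test_function phi := smooth phi /\
  exists2 K : set 'rV[R]_p, compact K & forall x, ~ K x -> phi x = 0.

(* A Lebesgue class is represented by a Borel function; all the notions below
   are insensitive to the choice of representative of the derivatives. *)
Definition locally_integrable_rV f := measurable_fun setT f /\
  forall K : set 'rV[R]_p, compact K -> (\int[mu]_(x in K) `|f x|%:E < +oo)%E.

Definition is_weak_partial (i : 'I_p) f h :=
  [/\ locally_integrable_rV f, locally_integrable_rV h &
    forall phi, test_function phi ->
      \int[mu]_x (f x * partial i phi x) = - \int[mu]_x (h x * phi x)].

Definition is_weak_gradient f F :=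
  forall i, is_weak_partial i f (fun x => F x 0 i).

Definition weakly_differentiable f := exists F, is_weak_gradient f F.

Definition weakly_differentiable_field F :=
  forall j, weakly_differentiable (fun x => F x 0 j).

Definition twice_weakly_differentiable f :=
  exists2 F, is_weak_gradient f F & weakly_differentiable_field F.

(* The divergence as a single distribution: the individual partial
   derivatives of the components of F need not be functions. *)
Definition is_weak_div F h :=
  [/\ forall i, locally_integrable_rV (fun x => F x 0 i),
    locally_integrable_rV h &
    forall phi, test_function phi ->
      \int[mu]_x (dotv (F x) (\row_i partial i phi x)) =
      - \int[mu]_x (h x * phi x)].

Definition is_weak_laplacian f h :=
  exists2 F, is_weak_gradient f F & is_weak_div F h.

End weak_derivatives.

Section spherical_symmetry.
Context {R : realType} {n : nat}.

(* The points z of the punctured unit ball with z / |z| in A; the normalized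
   surface measure of A on the sphere is the fraction of the ball that
   this cone occupies. *)
Definition unit_cone (A : set 'rV[R]_n) : set 'rV[R]_n :=
  [set z | 0 < enorm z <= 1 /\ A ((enorm z)^-1 *: z)].

Definition uniform_on_sphere d (Om : measurableType d) (Q : probability Om R)
    (V : Om -> 'rV[R]_n) :=
  forall A, measurable A ->
    (Q (V @^-1` A) * lebesgue_rV n (unit_cone setT) =
     lebesgue_rV n (unit_cone A))%E.

Definition independent_RV d d1 d2 (Om : measurableType d)
    (T1 : measurableType d1) (T2 : measurableType d2) (Q : probability Om R)
    (Y1 : Om -> T1) (Y2 : Om -> T2) :=
  forall A B, measurable A -> measurable B ->
    (Q (Y1 @^-1` A `&` Y2 @^-1` B) = Q (Y1 @^-1` A) * Q (Y2 @^-1` B))%E.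

Definition eq_in_law d1 d2 d (T1 : measurableType d1) (T2 : measurableType d2)
    (T : measurableType d) (P : probability T1 R) (Q : probability T2 R)
    (Y : T1 -> T) (Z : T2 -> T) :=
  forall A, measurable A -> P (Y @^-1` A) = Q (Z @^-1` A).

(* The radius and direction (Rad, V) are explicit so that a location family
   can share one radial distribution. *)
Definition spherically_symmetric d d' (T : measurableType d)
    (Om : measurableType d') (P : probability T R) (Y : T -> 'rV[R]_n)
    (mu : 'rV[R]_n) (Q : probability Om R) (Rad : {mfun Om >-> R})
    (V : {mfun Om >-> 'rV[R]_n}) :=
  [/\ forall w, 0 <= Rad w, independent_RV Q Rad V, uniform_on_sphere Q V &
    eq_in_law P Q Y (fun w => mu + Rad w *: V w)].

End spherical_symmetry.

Section loss_estimation.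
Context {R : realType} {p k : nat}.
Implicit Types (g : 'rV[R]_p -> 'rV[R]_p) (gamma divg : 'rV[R]_p -> R).

Definition shrinkage g (x : 'rV[R]_p) (u : 'rV[R]_k) : 'rV[R]_p :=
  x + sqnormv u *: g x.

(* divg stands for (a version of) the weak divergence of g. *)
Definition delta0 g divg (x : 'rV[R]_p) (u : 'rV[R]_k) : R :=
  p%:R / k%:R * sqnormv u +
  (sqnormv (g x) + 2 / (k + 2)%:R * divg x) * sqnormv u ^+ 2.

Definition delta_corr g divg gamma (x : 'rV[R]_p) (u : 'rV[R]_k) : R :=
  delta0 g divg x u - sqnormv u ^+ 2 * gamma x.

Context {d : measure_display} {T : measurableType d}.
Variables (P : 'rV[R]_p -> probability T R).
Variables (X : T -> 'rV[R]_p) (U : T -> 'rV[R]_k).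
Variable (est : 'rV[R]_p -> 'rV[R]_k -> 'rV[R]_p).
Implicit Types (theta : 'rV[R]_p) (delta : 'rV[R]_p -> 'rV[R]_k -> R).

Definition loss theta : T -> R := fun w => sqnormv (est (X w) (U w) - theta).

(* Valued in [0, +oo]: the integrand is nonnegative. *)
Definition risk delta theta : \bar R :=
  'E_(P theta)[fun w => ((delta (X w) (U w) - loss theta w) ^+ 2)%R]%E.

Definition dominates delta delta' :=
  (forall theta, risk delta theta <= risk delta' theta)%E /\
  exists theta, (risk delta theta < risk delta' theta)%E.

End loss_estimation.

(* Main.v *)
(* Condition on the radius r.  On the sphere of radius r around (theta, 0) the
   first p coordinates have a density proportional to s^(k/2 - 1), where
   s = r^2 - |x - theta|^2 is the value of |u|^2.  Since |g|^2 cancels in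
   delta0 - loss, the difference of the squared errors, times this density, is

     phi * (left-hand side of the differential inequality)
       - 4/(k+6) (gamma g . grad phi + div(gamma g) phi)
       + 2/((k+4)(k+6)) (gamma Lap phi - phi Lap gamma)
       - 2p (1/k - 1/(k+4)) s^((k+4)/2) gamma,

   with phi = s_+^((k+6)/2).  The second and third terms integrate to 0 because
   phi is a limit of the test functions s_+^((k+6)/2) exp(-e/s), and the others
   are nonpositive.  The comparison holds in [0, +oo] for each r and is then
   integrated over r. *)

Require Import Defs.
From HB Require Import structures.
From mathcomp Require Import all_boot all_order all_algebra.
From mathcomp Require Import all_classical all_reals all_analysis.
From mathcomp Require Import measurable_realfun.
From mathcomp Require Import ring.

Set Implicit Arguments.
Unset Strict Implicit.
Unset Printing Implicit Defensive.

Import Order.TTheory GRing.Theory Num.Theory.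
Import numFieldNormedType.Exports.

Local Open Scope classical_set_scope.
Local Open Scope ring_scope.

(** * Image measures and Lebesgue measure on R^n *)

(** The product [gamma * divg] of two locally integrable functions need not be locally integrable,
    so the left-hand side of the differential inequality is never integrated. It enters only through
    its sign: almost everywhere, the weighted squared error of [delta_corr] is at most that of
    [delta0] plus terms which are locally integrable functions times bounded weights supported in a
    ball. Only these terms are integrated by parts.

    Weak derivatives are tested on smooth functions, while a power of [s_+] may have only finitely
    many derivatives across the sphere [s = 0]. The factor [exp(-e/s)] repairs this at the price of
    a limit, which dominated convergence allows because the exponents left after two derivatives are
    still nonnegative.

    Strictness comes from the leftover term alone: at a radius where the risk of [delta0] is finite,
    the gain is at least a positive constant times the integral of [gamma * s_+^((k+4)/2)], which
    vanishes only if the two estimators agree almost surely on that sphere. *)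

Section image_measure.
Local Open Scope ereal_scope.
Context d1 d2 (X : measurableType d1) (Y : measurableType d2) (R : realType).

(** The canonical instance is named explicitly so that the measurability proof [mphi] can be
    supplied to it. *)
Definition image_measure (mu : {measure set X -> \bar R}) (phi : X -> Y)
    (mphi : measurable_fun setT phi) : {measure set Y -> \bar R} :=
  measure_function_pushforward__canonical__measure_function_Measure mu mphi.

(** [nu] is only required to agree with the image on measurable sets. It can then be
    [lebesgue_rV n.+1], a product of laws, or a law known through [eq_in_law]. *)
Lemma ge0_integral_image (mu : {measure set X -> \bar R})
    (nu : {measure set Y -> \bar R}) (phi : X -> Y) (f : Y -> \bar R) :
  measurable_fun setT phi ->
  (forall A, measurable A -> nu A = mu (phi @^-1` A)) ->
  measurable_fun setT f -> (forall y, 0 <= f y) ->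
  \int[nu]_y f y = \int[mu]_x f (phi x).
Proof.
move=> mphi nuE mf f0.
rewrite (eq_measure_integral (image_measure mu mphi)); last first.
  by move=> A mA _; rewrite nuE.
by rewrite ge0_integral_pushforward// preimage_setT.
Qed.

Lemma ge0_measurable_integral (m : {sigma_finite_measure set Y -> \bar R})
    (f : X -> Y -> \bar R) :
  measurable_fun setT (fun z : X * Y => f z.1 z.2) ->
  (forall x y, 0 <= f x y) -> measurable_fun setT (fun x => \int[m]_y f x y).
Proof.
by move=> mf f0; exact: (measurable_fun_fubini_tonelli_F (fun z => f z.1 z.2)).
Qed.

Lemma ge0_integral_swap (m1 : {sigma_finite_measure set X -> \bar R})
    (m2 : {sigma_finite_measure set Y -> \bar R}) (f : X -> Y -> \bar R) :
  measurable_fun setT (fun z : X * Y => f z.1 z.2) ->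
  (forall x y, 0 <= f x y) ->
  \int[m1]_x \int[m2]_y f x y = \int[m2]_y \int[m1]_x f x y.
Proof. by move=> mf f0; rewrite (fubini_tonelli (fun z => f z.1 z.2)). Qed.

End image_measure.

Section affine.
Context {R : realType}.
Local Open Scope ereal_scope.

Lemma measurable_affine (a r : R) :
  measurable_fun setT (fun t : R => (a + r * t)%R).
Proof. by apply: measurable_funD => //; exact: measurable_funM. Qed.

(** The image measure scaled by [r] agrees with Lebesgue measure on the intervals []u, v]], and
    these determine it. *)
Lemma ge0_integral_affine (f : R -> \bar R) (a r : R) :
  (0 < r)%R -> measurable_fun setT f -> (forall t, 0 <= f t) ->
  \int[lebesgue_measure]_t f t =
  r%:E * \int[lebesgue_measure]_t f (a + r * t)%R.
Proof.
move=> r0 mf f0.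
have maff : measurable_fun setT (fun t : R => (a + r * t)%R : measurableTypeR R).
  exact: measurable_affine.
pose rn : {nonneg R} := NngNum (ltW r0).
rewrite (eq_measure_integral
    (mscale rn (image_measure (@lebesgue_measure R) maff))); last first.
  move=> A mA _; apply: lebesgue_measure_unique => // _ [[u v]] _ <- /=.
  change (lebesgue_measure `]u, v] =
    r%:E * lebesgue_measure ((fun t : R => (a + r * t)%R) @^-1` `]u, v])).
  rewrite (_ : _ @^-1` _ = `]((u - a) / r)%R, ((v - a) / r)%R]%classic); last first.
    apply/seteqP; split => t /=; rewrite !in_itv/=.
    - by rewrite ltr_pdivrMr// ler_pdivlMr// ltrBlDl lerBrDl [(t * r)%R]mulrC.
    - by rewrite ltr_pdivrMr// ler_pdivlMr// ltrBlDl lerBrDl [(t * r)%R]mulrC.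
  rewrite lebesgue_measure_itv/= [X in _ = _ * X]lebesgue_measure_itv/= !lte_fin.
  rewrite ltr_pM2r ?invr_gt0// ltrD2r.
  case: ifPn => _; last by rewrite mule0.
  by rewrite -!EFinB -EFinM; congr EFin; field; rewrite gt_eqF.
rewrite ge0_integral_mscale//; congr (_ * _).
exact: ge0_integral_image.
Qed.

End affine.

Section lebesgue_rV_theory.
Context {R : realType}.
Local Open Scope ereal_scope.
Local Notation leb := (@lebesgue_measure R).

Lemma measurable_rV_consr n (t : R) :
  measurable_fun setT (fun v : 'rV[R]_n => rV_cons (t, v)).
Proof. exact: (measurableT_comp (@measurable_rV_cons R n)). Qed.

Lemma ge0_integral_rV_cons n (f : 'rV[R]_n.+1 -> \bar R) :
  measurable_fun setT f -> (forall y, 0 <= f y) ->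
  \int[lebesgue_rV n.+1]_x f x =
  \int[leb]_t \int[lebesgue_rV n]_v f (rV_cons (t, v)).
Proof.
move=> mf f0.
rewrite (@ge0_integral_image _ _ _ _ _ (leb \x lebesgue_rV n) _ (@rV_cons R n))//.
  rewrite fubini_tonelli1//.
  exact: (measurableT_comp mf (@measurable_rV_cons R n)).
exact: measurable_rV_cons.
Qed.

Lemma measurable_affine_rV n (a : 'rV[R]_n) (r : R) :
  measurable_fun setT (fun x : 'rV[R]_n => (a + r *: x)%R).
Proof.
apply: measurable_fun_rVP => i; under eq_fun do rewrite !mxE.
apply: measurable_funD => //; apply: measurable_funM => //.
exact: measurable_coord.
Qed.

(** Induction on the dimension: the substitution is made in the tail, then in the first coordinate,
    each coordinate contributing one factor [r]. *)
Lemma ge0_integral_affine_rV n (f : 'rV[R]_n -> \bar R) (a : 'rV[R]_n) (r : R) :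
  (0 < r)%R -> measurable_fun setT f -> (forall x, 0 <= f x) ->
  \int[lebesgue_rV n]_x f x =
  (r ^+ n)%:E * \int[lebesgue_rV n]_x f (a + r *: x)%R.
Proof.
move=> r0; elim: n f a => [|n IH] f a mf f0.
  rewrite expr0 mul1e; apply: eq_integral => x _.
  by congr f; apply/rowP => -[].
have mcons := measurableT_comp mf (@measurable_rV_cons R n).
have mfr : measurable_fun setT (fun x : 'rV[R]_n.+1 => f (a + r *: x)%R).
  exact: (measurableT_comp mf (measurable_affine_rV _ _)).
have mcons' := measurableT_comp mfr (@measurable_rV_cons R n).
rewrite !ge0_integral_rV_cons//.
pose b := (rV_uncons a).2.
have mint : measurable_fun setT
    (fun t : R => \int[lebesgue_rV n]_v f (rV_cons (t, (b + r *: v)%R))).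
  apply: ge0_measurable_integral => //.
  apply: (measurableT_comp mf); apply: (measurableT_comp (@measurable_rV_cons R n)).
  apply: measurable_fun_pair => //=.
  exact: (measurableT_comp (measurable_affine_rV _ _)).
transitivity (\int[leb]_t ((r ^+ n)%:E *
    \int[lebesgue_rV n]_v f (rV_cons (t, (b + r *: v)%R)))).
  apply: eq_integral => t _; apply: IH => //.
  exact: (measurableT_comp mf (measurable_rV_consr t)).
rewrite ge0_integralZl; [|exact: measurableT|exact mint| |]; last 2 first.
- by move=> t _; exact: integral_ge0.
- by rewrite lee_fin exprn_ge0// ltW.
rewrite [in LHS](@ge0_integral_affine _ _ (a ord0 ord0) r); [|exact: r0|exact mint|]; last first.
  by move=> t; exact: integral_ge0.
rewrite muleA -EFinM -exprSr; congr (_ * _).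
apply: eq_integral => t _; apply: eq_integral => v _; congr f.
apply/rowP => i; rewrite !mxE; case: unliftP => [j ->|->]; by rewrite ?mxE.
Qed.

(** The dimensions [p.+1 + k] and [(p + k).+1] are convertible, which lets the induction in
    [ge0_integral_row_mx] peel off one coordinate. *)
Lemma row_mx_cons p k (t : R) (v : 'rV[R]_p) (u : 'rV[R]_k) :
  row_mx (rV_cons (t, v)) u = rV_cons (t, row_mx v u) :> 'rV[R]_(p.+1 + k).
Proof.
apply/rowP => i; rewrite !mxE.
case: splitP => j ij.
  rewrite mxE; case: unliftP => [j' j'E|jE].
    have -> : i = lift ord0 (lshift k j').
      by apply: val_inj; apply: (etrans ij); rewrite j'E.
    by rewrite liftK row_mxEl.
  by rewrite (_ : i = ord0) ?unlift_none//; apply: val_inj; apply: (etrans ij); rewrite jE.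
have -> : i = lift ord0 (rshift p j) by apply: val_inj; apply: (etrans ij).
by rewrite liftK row_mxEr.
Qed.

Lemma measurable_row_mx p k :
  measurable_fun setT (fun z : 'rV[R]_p * 'rV[R]_k => row_mx z.1 z.2).
Proof.
apply: measurable_fun_rVP => i; under eq_fun do rewrite mxE.
case: (fintype.split i) => j.
- exact: (measurableT_comp (@measurable_coord R p j)).
- exact: (measurableT_comp (@measurable_coord R k j)).
Qed.

Lemma ge0_integral_row_mx p k (f : 'rV[R]_(p + k) -> \bar R) :
  measurable_fun setT f -> (forall x, 0 <= f x) ->
  \int[lebesgue_rV (p + k)]_z f z =
  \int[lebesgue_rV p]_x \int[lebesgue_rV k]_u f (row_mx x u).
Proof.
elim: p f => [|p IH] f mf f0.
  (* [lebesgue_rV 0] is a Dirac mass, so the outer integral is an evaluation. *)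
  rewrite [RHS]integral_dirac//= ?diracT ?mul1e.
    apply: eq_integral => u _; congr f; apply/rowP => i.
    by rewrite mxE; case: splitP => [[]//|j ij]; congr (u _ _); apply: val_inj.
  apply: ge0_measurable_integral => //.
  exact: (measurableT_comp mf (@measurable_row_mx 0 k)).
rewrite (@ge0_integral_rV_cons (p + k))//.
rewrite ge0_integral_rV_cons//; last 2 first.
- apply: ge0_measurable_integral => //.
  exact: (measurableT_comp mf (@measurable_row_mx p.+1 k)).
- by move=> x; exact: integral_ge0.
apply: eq_integral => t _.
rewrite IH; last 2 first.
- exact: (measurableT_comp mf (@measurable_rV_consr (p + k) t)).
- by move=> z; exact: f0.
apply: eq_integral => x _; apply: eq_integral => u _.
by rewrite row_mx_cons.
Qed.

End lebesgue_rV_theory.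

(** * Law of the squared norm *)

Section measurable_real_functions.
Context d (T : measurableType d) (R : realType).
Implicit Types f g : T -> R.

Lemma measurable_funV f :
  measurable_fun setT f -> measurable_fun setT (fun x => (f x)^-1).
Proof.
move=> mf; apply: (@measurableT_comp _ _ _ _ _ _ (@GRing.inv R)) => //.
(* Inversion is discontinuous at 0, so it is read as the real power of exponent -1 on each
   half-line; at 0 both conventions give 0. *)
rewrite (_ : GRing.inv = fun x : R =>
    if 0 <= x then x `^ (-1) else - ((- x) `^ (-1))); last first.
  apply/funext => x; case: ifPn => [x0|]; first by rewrite powR_inv1.
  by rewrite -ltNge => x0; rewrite powR_inv1 ?oppr_ge0 ?ltW// invrN opprK.
apply: measurable_fun_ifT.
- exact: measurable_fun_ler.
- exact: measurable_powR.
- apply: measurableT_comp => //.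
  exact: (measurableT_comp (measurable_powR _)).
Qed.

Lemma measurable_fun_div f g : measurable_fun setT f -> measurable_fun setT g ->
  measurable_fun setT (fun x => f x / g x).
Proof. by move=> mf mg; apply: measurable_funM => //; exact: measurable_funV. Qed.

Lemma measurable_fun_sqrt f :
  measurable_fun setT f -> measurable_fun setT (fun x => Num.sqrt (f x)).
Proof.
move=> mf; apply: (@measurableT_comp _ _ _ _ _ _ (@Num.sqrt R)) => //.
by apply: continuous_measurable_fun; exact: sqrt_continuous.
Qed.

End measurable_real_functions.

(** * Squared norm and volume of the unit ball *)

Section sqnorm.
Context {R : realType}.

Lemma measurable_sqnormv n : measurable_fun setT (@sqnormv R n).
Proof.
apply: measurable_sum => i; apply: measurable_funM; exact: measurable_coord.
Qed.

Lemma measurable_enorm n : measurable_fun setT (@enorm R n).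
Proof. by apply: measurable_fun_sqrt; exact: measurable_sqnormv. Qed.

Lemma sqnormv_ge0 n (x : 'rV[R]_n) : 0 <= sqnormv x.
Proof. by apply: sumr_ge0 => i _; rewrite -expr2 sqr_ge0. Qed.

Lemma sqnormvZ n a (x : 'rV[R]_n) : sqnormv (a *: x) = a ^+ 2 * sqnormv x.
Proof. by rewrite /sqnormv /dotv mulr_sumr; apply: eq_bigr => i _; rewrite mxE; ring. Qed.

Lemma sqnormv_row_mx p k (x : 'rV[R]_p) (u : 'rV[R]_k) :
  sqnormv (row_mx x u) = sqnormv x + sqnormv u.
Proof.
rewrite /sqnormv /dotv big_split_ord/=; congr (_ + _); apply: eq_bigr => i _.
  by rewrite !row_mxEl.
by rewrite !row_mxEr.
Qed.

Lemma sqnormv_eq0 n (x : 'rV[R]_n) : (sqnormv x == 0) = (x == 0).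
Proof.
apply/eqP/eqP => [x0|->]; last by rewrite /sqnormv /dotv big1// => i _; rewrite mxE mul0r.
apply/rowP => i; rewrite mxE; apply/eqP.
have /psumr_eq0P : forall i : 'I_n, true -> 0 <= x 0 i * x 0 i by move=> j _; rewrite -expr2 sqr_ge0.
by move=> /(_ x0) /(_ i isT) /eqP; rewrite mulf_eq0 orbb.
Qed.

Lemma enorm_gt0 n (x : 'rV[R]_n) : (0 < enorm x) = (0 < sqnormv x).
Proof. by rewrite sqrtr_gt0. Qed.

Lemma enorm_le1 n (x : 'rV[R]_n) : (enorm x <= 1) = (sqnormv x <= 1).
Proof. by rewrite -[RHS]ler_sqrt// sqrtr1. Qed.

Local Open Scope ereal_scope.

(** The origin is a box with null sides; in dimension 0 the measure is a Dirac mass and the point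
    has mass 1. *)
Lemma lebesgue_rV_set0 n : (0 < n)%N -> lebesgue_rV n [set (0%R : 'rV[R]_n)] = 0.
Proof.
move=> n0; have := @lebesgue_rV_box R n (fun=> [set 0%R]) (fun=> measurable_set1 _).
rewrite (_ : [set x : 'rV[R]_n | _] = [set 0%R]); last first.
  apply/seteqP; split => x /=; first by move=> x0; apply/rowP => i; rewrite x0 mxE.
  by move=> -> i; rewrite mxE.
move=> ->; rewrite (bigD1 (Ordinal n0))//= [X in X * _]lebesgue_measure_set1.
by rewrite mul0e.
Qed.

Lemma measurable_unit_cone n (A : set 'rV[R]_n) :
  measurable A -> measurable (unit_cone A).
Proof.
move=> mA.
have mnorm : measurable_fun setT (fun z : 'rV[R]_n => ((enorm z)^-1 *: z)%R).
  apply: measurable_fun_rVP => i; under eq_fun do rewrite mxE.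
  apply: measurable_funM; last exact: measurable_coord.
  by apply: measurable_funV; exact: measurable_enorm.
rewrite (_ : unit_cone A = (@enorm R n) @^-1` `]0%R, 1%R] `&`
    ((fun z : 'rV[R]_n => ((enorm z)^-1 *: z)%R) @^-1` A)); last first.
  by apply/seteqP; split => z /=; rewrite in_itv/=.
apply: measurableI.
- by rewrite -[X in measurable X]setTI; exact: measurable_enorm.
- by rewrite -[X in measurable X]setTI; exact: mnorm.
Qed.

(** The ball lies in the cube of side [[-1, 1]]. *)
Lemma unit_cone_fin n : lebesgue_rV n (unit_cone (setT : set 'rV[R]_n)) < +oo.
Proof.
have mI (i : 'I_n) : measurable (`[(-1)%R, 1%R]%classic : set R) by exact: measurable_itv.
apply: (@le_lt_trans _ _ (lebesgue_rV n
    [set x : 'rV[R]_n | forall i, `[(-1)%R, 1%R]%classic (x 0%R i)])).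
  apply: le_measure; rewrite ?inE.
  - by apply: measurable_unit_cone; exact: measurableT.
  - exact: (measurable_rV_box mI).
  - move=> x [/andP[_ x1] _] i /=; rewrite in_itv/= -ler_norml.
    rewrite -(@ler_sqr R) ?nnegrE// real_normK ?num_real// expr1n.
    move: x1; rewrite enorm_le1; apply: le_trans.
    rewrite /sqnormv /dotv (bigD1 i)//= -expr2 lerDl.
    by apply: sumr_ge0 => j _; rewrite -expr2 sqr_ge0.
rewrite (lebesgue_rV_box mI).
under eq_bigr do rewrite lebesgue_measure_itv/= lte_fin ifT ?gtrN ?ltr01//.
by rewrite prodEFin ltry.
Qed.

(** The ball contains the cube of side []0, 1/n]]: there each square is at most [1/n], one factor
    being at most [1/n] and the other at most 1. Excluding 0 keeps the cube inside the punctured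
    ball. *)
Lemma unit_cone_gt0 n : (0 < n)%N ->
  0 < lebesgue_rV n (unit_cone (setT : set 'rV[R]_n)).
Proof.
move=> n0; have n0' : (0 < n%:R^-1 :> R)%R by rewrite invr_gt0 ltr0n.
have mI (i : 'I_n) : measurable (`]0%R, (n%:R^-1)%R]%classic : set R) by exact: measurable_itv.
apply: (@lt_le_trans _ _ (lebesgue_rV n
    [set x : 'rV[R]_n | forall i, `]0%R, (n%:R^-1)%R]%classic (x 0%R i)])).
  rewrite (lebesgue_rV_box mI).
  under eq_bigr do rewrite lebesgue_measure_itv/= lte_fin ifT//.
  by rewrite prodEFin lte_fin; apply: prodr_gt0 => i _; rewrite subr0.
apply: le_measure; rewrite ?inE.
- exact: (measurable_rV_box mI).
- by apply: measurable_unit_cone; exact: measurableT.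
move=> x /= xI; split => //; rewrite enorm_gt0 enorm_le1; apply/andP; split.
  rewrite /sqnormv /dotv (bigD1 (Ordinal n0))//= ltr_pwDl//.
    by have := xI (Ordinal n0); rewrite in_itv/= => /andP[x0 _]; rewrite mulr_gt0.
  by apply: sumr_ge0 => j _; rewrite -expr2 sqr_ge0.
apply: (@le_trans _ _ (\sum_(i < n) n%:R^-1)%R).
  apply: ler_sum => i _; have := xI i; rewrite in_itv/= => /andP[x0 x1].
  rewrite -[leRHS]mulr1; apply: ler_pM => //; [exact: ltW|exact: ltW|].
  apply: (le_trans x1).
  by rewrite invf_le1 ?ltr0n// ler1n.
by rewrite sumr_const card_ord -[(_^-1 *+ _)%R]mulr_natr mulVf// pnatr_eq0 -lt0n.
Qed.

End sqnorm.

Section radial_law.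
Context {R : realType}.
Local Open Scope ereal_scope.
Local Notation leb := (@lebesgue_measure R).

(* Up to a constant, the density t^(k/2 - 1) of the image of Lebesgue measure
   on R^k under the squared norm. *)
Definition radw k (t : R) : R := (if 0 < t then Num.sqrt t ^+ k / t else 0)%R.

Lemma radw_ge0 k t : (0 <= radw k t)%R.
Proof. by rewrite /radw; case: ifPn => // t0; rewrite divr_ge0// ltW. Qed.

Lemma measurable_radw k : measurable_fun setT (radw k).
Proof.
apply: measurable_fun_ifT => //; first exact: measurable_fun_ltr.
apply: measurable_fun_div => //.
by apply: measurable_funX; exact: measurable_fun_sqrt.
Qed.

(** The kernel in [s] obtained from the weight [sqrt s ^+ k] on [[1, 2]] by the substitution that
    replaces [s * q] by [s]. *)
Let W k (s q : R) : R :=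
  (if [&& 0 < q, q <= s & s <= 2 * q] then q^-1 * Num.sqrt (s / q) ^+ k else 0)%R.

Let W_ge0 k s q : (0 <= W k s q)%R.
Proof.
rewrite /W; case: ifPn => // /and3P[q0 _ _].
by rewrite mulr_ge0 ?exprn_ge0// invr_ge0 ltW.
Qed.

Let measurable_W d (T : measurableType d) k (f g : T -> R) :
  measurable_fun setT f -> measurable_fun setT g ->
  measurable_fun setT (fun x => W k (f x) (g x)).
Proof.
move=> mf mg; apply: measurable_fun_ifT => //.
- apply: measurable_and; first exact: measurable_fun_ltr.
  apply: measurable_and; first exact: measurable_fun_ler.
  by apply: measurable_fun_ler => //; exact: measurable_funM.
- apply: measurable_funM; first exact: measurable_funV.
  by apply: measurable_funX; apply: measurable_fun_sqrt; exact: measurable_fun_div.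
Qed.

(* By scaling, I = int h(|u|^2) du equals s^(k/2) int h(s |u|^2) du for every
   s > 0; average this over s in [1, 2], exchange the integrals and substitute
   t = s |u|^2, then u = sqrt t v. *)
Lemma radial_law k : (0 < k)%N -> exists2 c : \bar R, 0 <= c &
  forall h : R -> \bar R, measurable_fun setT h -> (forall t, 0 <= h t) ->
  \int[lebesgue_rV k]_u h (sqnormv u) =
  \int[leb]_t ((radw k t)%:E * h t) * c.
Proof.
(* This constant is left in [[0, +oo]]. Only the constant finally built from it is shown to be
   finite and positive, in [sphere_section]. *)
move=> k0; exists (\int[lebesgue_rV k]_v (W k 1 (sqnormv v))%:E).
  by apply: integral_ge0 => v _; rewrite lee_fin.
move=> h mh h0.
have msq := @measurable_sqnormv R k.
have mhs (s : R) : measurable_fun setT (fun u : 'rV[R]_k => h (s * sqnormv u)%R).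
  by apply: (measurableT_comp mh); exact: measurable_funM.
set I0 := LHS.
have I00 : 0 <= I0 by apply: integral_ge0.
have I0E s : (0 < s)%R -> I0 = (Num.sqrt s ^+ k)%:E *
    \int[lebesgue_rV k]_u h (s * sqnormv u)%R.
  move=> s0; rewrite /I0 (@ge0_integral_affine_rV _ _ _ 0 (Num.sqrt s))//.
  - congr (_ * _); apply: eq_integral => u _.
    by rewrite add0r sqnormvZ sqr_sqrtr// ltW.
  - by rewrite sqrtr_gt0.
  - exact: (measurableT_comp mh).
pose b (s : R) : R := if (1 <= s <= 2)%R then (Num.sqrt s ^+ k)%R else 0%R.
have b0 s : (0 <= b s)%R by rewrite /b; case: ifPn.
have mb : measurable_fun setT b.
  apply: measurable_fun_ifT => //.
    by apply: measurable_and; exact: measurable_fun_ler.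
  by apply: measurable_funX; exact: measurable_fun_sqrt.
have -> : I0 = \int[leb]_s \int[lebesgue_rV k]_u ((b s)%:E * h (s * sqnormv u)%R).
  transitivity (\int[leb]_(s in `[1%R, 2%R]) cst I0 s).
    rewrite integral_cst// [X in _ * X]lebesgue_measure_itv/= lte_fin ltr1n.
    by rewrite -EFinB (_ : 2 - 1 = 1)%R ?mule1//; ring.
  rewrite integral_mkcond; apply: eq_integral => s _.
  under eq_integral do rewrite muleC.
  rewrite ge0_integralZr//= ?lee_fin//.
  rewrite patchE mem_setE in_itv/= /b; case: ifPn => [/andP[s1 _]|_]; last by rewrite mule0.
  by rewrite muleC -I0E// (lt_le_trans ltr01).
have mbh : measurable_fun setT (fun z : R * 'rV[R]_k => (b z.1)%:E * h (z.1 * sqnormv z.2)%R).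
  apply: emeasurable_funM; first exact/measurable_EFinP/(measurableT_comp mb).
  apply: (measurableT_comp mh); apply: measurable_funM => //.
  exact: (measurableT_comp msq).
transitivity (\int[lebesgue_rV k]_u \int[leb]_s ((b s)%:E * h (s * sqnormv u)%R)).
  apply: ge0_integral_swap; first exact: mbh.
  by move=> x u; rewrite mule_ge0// lee_fin.
have mWh : measurable_fun setT (fun z : 'rV[R]_k * R =>
    (W k z.2 (sqnormv z.1))%:E * h z.2).
  apply: emeasurable_funM; last exact: (measurableT_comp mh).
  by apply/measurable_EFinP; apply: measurable_W => //; exact: (measurableT_comp msq).
have Wh0 s q : 0 <= (W k s q)%:E * h s by rewrite mule_ge0// lee_fin.
have mWhq q : measurable_fun setT (fun s : R => (W k s q)%:E * h s).
  by apply: emeasurable_funM => //; apply/measurable_EFinP; exact: measurable_W.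
(* The substitution in [s] divides by [sqnormv u], so the inner integrals agree only off the origin,
   which is null because [k > 0]. *)
transitivity (\int[lebesgue_rV k]_u \int[leb]_s ((W k s (sqnormv u))%:E * h s)).
  apply: ge0_ae_eq_integral => //.
  - apply: (@ge0_measurable_integral _ _ _ _ _ leb (fun u s => (b s)%:E * h (s * sqnormv u)%R)).
      exact: (measurableT_comp mbh (@measurable_swap _ _ _ _)).
    by move=> x u; rewrite mule_ge0// lee_fin.
  - exact: (@ge0_measurable_integral _ _ _ _ _ leb (fun u s => (W k s (sqnormv u))%:E * h s)).
  - by move=> u _; apply: integral_ge0 => s _; rewrite mule_ge0// lee_fin.
  - by move=> u _; exact: integral_ge0.
  - exists [set (0%R : 'rV[R]_k)]; split.
    + rewrite (_ : [set 0%R] = sqnormv @^-1` [set (0 : R)%R]); last first.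
        by apply/seteqP; split => u /= /eqP; rewrite ?sqnormv_eq0 => /eqP //;
          move=> /eqP; rewrite -sqnormv_eq0 => /eqP.
      by rewrite -[X in measurable X]setTI; apply: msq.
    + exact: lebesgue_rV_set0.
    move=> u /= /not_implyP[_]; apply: contra_notP => /eqP u0.
    have q0 : (0 < sqnormv u)%R by rewrite lt_neqAle sqnormv_ge0 eq_sym sqnormv_eq0 u0.
    set q := sqnormv u in q0 *.
    rewrite [RHS](@ge0_integral_affine _ _ 0 q)//.
    rewrite -ge0_integralZl//; last 2 first.
      exact: (measurableT_comp (mWhq q) (measurable_affine 0 q)).
      by rewrite lee_fin ltW.
    apply: eq_integral => s _; rewrite add0r muleA -EFinM [(q * s)%R]mulrC; congr (_%:E * _).
    rewrite /W q0/= /b ler_pMl// ler_pM2r// mulfK ?gt_eqF//.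
    by case: ifPn => _; rewrite ?mulr0// mulrA mulfV ?mul1r// gt_eqF.
transitivity (\int[leb]_s \int[lebesgue_rV k]_u ((W k s (sqnormv u))%:E * h s)).
  by apply: ge0_integral_swap.
rewrite -ge0_integralZr//; last 3 first.
- by apply: emeasurable_funM => //; apply/measurable_EFinP; exact: measurable_radw.
- by move=> t _; rewrite mule_ge0// lee_fin radw_ge0.
- by apply: integral_ge0 => v _; rewrite lee_fin.
have mWt t : measurable_fun setT (fun u : 'rV[R]_k => (W k t (sqnormv u))%:E).
  by apply/measurable_EFinP; apply: measurable_W => //; exact: msq.
apply: eq_integral => t _ /=.
rewrite ge0_integralZr//; last by move=> *; rewrite lee_fin.
rewrite /radw; case: ifPn => [t0|]; last first.
  rewrite -leNgt => t0; rewrite mul0e mul0e integral0_eq ?mul0e// => u _.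
  rewrite /W; case: ifPn => // /and3P[q0 qt _].
  by have := lt_le_trans q0 (le_trans qt t0); rewrite ltxx.
rewrite (@ge0_integral_affine_rV _ _ _ 0 (Num.sqrt t))//; last 2 first.
- by rewrite sqrtr_gt0.
- by move=> u; rewrite lee_fin.
transitivity ((Num.sqrt t ^+ k)%:E *
    (t^-1%:E * \int[lebesgue_rV k]_v (W k 1 (sqnormv v))%:E) * h t).
  congr (_ * _ * _); rewrite -ge0_integralZl//; last 2 first.
    by move=> u _; rewrite lee_fin.
    by rewrite lee_fin invr_ge0 ltW.
  apply: eq_integral => u _; rewrite -EFinM; congr EFin.
  rewrite add0r sqnormvZ sqr_sqrtr ?(ltW t0)// /W.
  rewrite pmulr_rgt0// -[X in (_ * _ <= X)%R]mulr1 ler_pM2l//.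
  rewrite mulrCA -[X in (X <= t * _)%R]mulr1 ler_pM2l//.
  case: ifPn => [/and3P[q0 _ _]|_]; last by rewrite mulr0.
  have -> : (t / (t * sqnormv u) = 1 / sqnormv u)%R by field; rewrite !gt_eqF.
  by rewrite invfM mulrA.
by rewrite EFinM !muleA; rewrite -!muleA; congr (_ * (_ * _)); rewrite muleC.
Qed.

End radial_law.

(** * Marginals of the uniform distribution on the sphere *)

Section measurable_rV_functions.
Context d (T : measurableType d) (R : realType) (n : nat).
Implicit Types f g : T -> 'rV[R]_n.

Lemma measurable_oppr (h : T -> R) :
  measurable_fun setT h -> measurable_fun setT (fun x => - h x).
Proof. exact: measurableT_comp. Qed.

Lemma measurable_rV_coord f i :
  measurable_fun setT f -> measurable_fun setT (fun x => f x 0 i).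
Proof. by move=> mf; exact: (measurableT_comp (@measurable_coord R n i)). Qed.

Lemma measurable_rVD f g : measurable_fun setT f -> measurable_fun setT g ->
  measurable_fun setT (fun x => f x + g x).
Proof.
move=> mf mg; apply: measurable_fun_rVP => i; under eq_fun do rewrite mxE.
by apply: measurable_funD; exact: measurable_rV_coord.
Qed.

Lemma measurable_rVN f : measurable_fun setT f -> measurable_fun setT (fun x => - f x).
Proof.
move=> mf; apply: measurable_fun_rVP => i; under eq_fun do rewrite mxE.
by apply: measurable_oppr; exact: measurable_rV_coord.
Qed.

Lemma measurable_rVZ (a : T -> R) f : measurable_fun setT a -> measurable_fun setT f ->
  measurable_fun setT (fun x => a x *: f x).
Proof.
move=> ma mf; apply: measurable_fun_rVP => i; under eq_fun do rewrite mxE.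
by apply: measurable_funM => //; exact: measurable_rV_coord.
Qed.

End measurable_rV_functions.

Lemma measurable_lsubmx (R : realType) p k :
  measurable_fun setT (fun z : 'rV[R]_(p + k) => lsubmx z).
Proof.
apply: measurable_fun_rVP => i; under eq_fun do rewrite mxE.
exact: measurable_coord.
Qed.

Lemma measurable_rsubmx (R : realType) p k :
  measurable_fun setT (fun z : 'rV[R]_(p + k) => rsubmx z).
Proof.
apply: measurable_fun_rVP => i; under eq_fun do rewrite mxE.
exact: measurable_coord.
Qed.

Section measurable_eta.
Variable R : realType.

(** Point-free forms, for the leaves at which [mfun] meets an operation without its argument. *)
Lemma measurable_sqrt : measurable_fun setT (@Num.sqrt R).
Proof. exact: measurable_fun_sqrt. Qed.

Lemma measurable_inv : measurable_fun setT (@GRing.inv R).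
Proof. exact: measurable_funV. Qed.

Lemma measurable_gt (a : R) : measurable_fun setT (> a).
Proof. exact: measurable_fun_ltr. Qed.

Lemma measurable_ge (a : R) : measurable_fun setT (>= a).
Proof. exact: measurable_fun_ler. Qed.

End measurable_eta.

(** Recursion on the syntax of the function; leaves that no rule closes are handed back as goals. *)
Ltac mfun := lazymatch goal with
  | |- measurable_fun _ (fun x => @?b x && @?c x) => apply: measurable_and; mfun
  | |- measurable_fun _ (fun x => (@?f x < @?g x)%R) => apply: measurable_fun_ltr; mfun
  | |- measurable_fun _ (fun x => (@?f x <= @?g x)%R) => apply: measurable_fun_ler; mfun
  | |- measurable_fun _ (fun x => (@?f x * @?g x)%E) => apply: emeasurable_funM; mfun
  | |- measurable_fun _ (fun x => (@?f x)%:E) => apply/measurable_EFinP; mfun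
  | |- measurable_fun _ (fun x => Num.sqrt (@?f x)) => apply: measurable_fun_sqrt; mfun
  | |- measurable_fun _ (fun x => ((@?f x)^-1)%R) => apply: measurable_funV; mfun
  | |- measurable_fun _ (fun x => ((@?f x) ^+ _)%R) => apply: measurable_funX; mfun
  | |- measurable_fun _ (fun x => sqnormv (@?f x)) =>
      apply: (measurableT_comp (@measurable_sqnormv _ _)); mfun
  | |- measurable_fun _ (fun x => radw _ (@?f x)) =>
      apply: (measurableT_comp (measurable_radw _)); mfun
  | |- measurable_fun _ (fun x => (- (@?f x))%R) =>
      first [apply: measurable_rVN | apply: measurable_oppr]; mfun
  | |- measurable_fun _ (fun x => (@?f x + @?g x)%R) =>
      first [apply: measurable_rVD | apply: measurable_funD]; mfun
  | |- measurable_fun _ (fun x => (@?f x * @?g x)%R) => apply: measurable_funM; mfun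
  | |- measurable_fun _ (fun x => (@?f x *: @?g x)%R) => apply: measurable_rVZ; mfun
  | |- measurable_fun _ (fun x => (@?f x, @?g x)) => apply: measurable_fun_pair; mfun
  | |- measurable_fun _ (fun x => lsubmx (@?f x)) =>
      apply: (measurableT_comp (@measurable_lsubmx _ _ _)); mfun
  | |- measurable_fun _ (fun x => rsubmx (@?f x)) =>
      apply: (measurableT_comp (@measurable_rsubmx _ _ _)); mfun
  | |- _ => first
    [ exact: measurable_cst | exact: measurable_id | assumption
    | exact: measurable_fst | exact: measurable_snd
    | exact: (measurableT_comp measurable_fst measurable_fst)
    | exact: (measurableT_comp measurable_snd measurable_fst)
    | exact: (measurableT_comp measurable_fst measurable_snd)
    | exact: (measurableT_comp measurable_snd measurable_snd)
    | exact: measurable_sqnormv | exact: measurable_radw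
    | exact: measurable_lsubmx | exact: measurable_rsubmx
    | exact: measurable_sqrt | exact: measurable_inv
    | exact: measurable_gt | exact: measurable_ge
    | apply: measurable_fun_ifT; mfun
    | idtac ]
  end.

Section restricted_measure.
Local Open Scope ereal_scope.

(** The complement of [D] is null for the restricted measure, and on subsets of [D] the two measures
    agree. *)
Lemma ge0_integral_mrestr d (T : measurableType d) (R : realType)
    (mu : {measure set T -> \bar R}) (D : set T) (mD : measurable D)
    (f : T -> \bar R) :
  measurable_fun setT f -> (forall x, 0 <= f x) ->
  \int[mrestr mu mD]_x f x = \int[mu]_(x in D) f x.
Proof.
move=> mf f0; transitivity (\int[mrestr mu mD]_(x in setT `\` ~` D) f x).
  apply: ge0_negligible_integral => //; first exact: measurableC.
  by rewrite /= /mrestr setICl measure0.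
rewrite setTD setCK; apply: eq_measure_integral => A mA AD.
by rewrite /= /mrestr setIidl.
Qed.

End restricted_measure.

Section sphere.
Context {R : realType}.
Local Open Scope ereal_scope.
Local Notation leb := (@lebesgue_measure R).

(** Up to the volume of the ball, the law of [V] is the image of Lebesgue measure on the punctured
    ball under normalization; both sides are images of measures that agree on every measurable
    set. *)
Lemma uniform_on_sphere_integral n d (Om : measurableType d)
    (Q : probability Om R) (V : Om -> 'rV[R]_n) (F : 'rV[R]_n -> \bar R) :
  measurable_fun setT V -> uniform_on_sphere Q V ->
  measurable_fun setT F -> (forall z, 0 <= F z) ->
  lebesgue_rV n (unit_cone setT) * \int[Q]_w F (V w) =
  \int[lebesgue_rV n]_z
    (if (0 < sqnormv z <= 1)%R then F ((enorm z)^-1 *: z)%R else 0).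
Proof.
move=> mV unifV mF F0.
have mC : measurable (unit_cone (setT : set 'rV[R]_n)) by exact: measurable_unit_cone.
have wfin : lebesgue_rV n (unit_cone (setT : set 'rV[R]_n)) \is a fin_num.
  by rewrite ge0_fin_numE//; exact: unit_cone_fin.
have w0 : (0 <= fine (lebesgue_rV n (unit_cone (setT : set 'rV[R]_n))))%R.
  by apply: fine_ge0.
have mN : measurable_fun setT (fun z : 'rV[R]_n => ((enorm z)^-1 *: z)%R).
  by apply: measurable_rVZ => //; apply: measurable_funV; exact: measurable_enorm.
transitivity (\int[mscale (NngNum w0) (image_measure Q mV)]_z F z).
  rewrite ge0_integral_mscale//= fineK//; congr (_ * _).
  by apply/esym/ge0_integral_image.
transitivity (\int[image_measure (mrestr (lebesgue_rV n) mC) mN]_z F z).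
  apply: eq_measure_integral => A mA _.
  rewrite /= /mscale/= fineK// muleC.
  transitivity (lebesgue_rV n (unit_cone A)); first exact: unifV.
  congr (lebesgue_rV n _); apply/seteqP; split => z /=.
    by case.
  by case=> ? [].
rewrite (@ge0_integral_image _ _ _ _ _ (mrestr (lebesgue_rV n) mC) _ _ _ mN)//.
rewrite ge0_integral_mrestr//; last exact: (measurableT_comp mF mN).
rewrite integral_mkcond; apply: eq_integral => z _.
rewrite patchE; congr (if _ then _ else _).
apply/idP/idP; rewrite inE /unit_cone/=.
  by case; rewrite enorm_gt0 enorm_le1.
by move=> z01; split => //; rewrite enorm_gt0 enorm_le1.
Qed.

Lemma radwM k (a t : R) : (0 < a)%R -> radw k (a ^+ 2 * t) = (a ^+ k / a ^+ 2 * radw k t)%R.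
Proof.
move=> a0; rewrite /radw pmulr_rgt0 ?exprn_gt0//; case: ifPn => t0; last by rewrite mulr0.
rewrite sqrtrM ?sqr_ge0// sqrtr_sqr gtr0_norm// exprMn; field.
by rewrite !gt_eqF.
Qed.

(* On the sphere of radius r around (theta, 0), |u|^2 is sqgap r theta x. *)
Definition sqgap p (r : R) (theta x : 'rV[R]_p) : R := (r ^+ 2 - sqnormv (x - theta))%R.

Lemma measurable_sqgap p r theta : measurable_fun setT (@sqgap p r theta).
Proof. by rewrite /sqgap; mfun. Qed.

(* The unit cone is split into R^p and R^k; after passing from u to
   t = |u|^2 and then to t + |x|^2, the norm of (x, u) no longer depends on x,
   so that x can be rescaled. *)
Lemma sphere_section_cone p k (r : R) (theta : 'rV[R]_p) d (Om : measurableType d)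
    (Q : probability Om R) (V : Om -> 'rV[R]_(p + k)) :
  (0 < k)%N -> (0 < r)%R -> measurable_fun setT V -> uniform_on_sphere Q V ->
  exists2 K : \bar R, 0 <= K & forall G : 'rV[R]_p * R -> \bar R,
    measurable_fun setT G -> (forall y, 0 <= G y) ->
    lebesgue_rV (p + k) (unit_cone setT) *
    \int[Q]_w G (theta + r *: lsubmx (V w), r ^+ 2 * sqnormv (rsubmx (V w)))%R =
    \int[lebesgue_rV p]_x
      ((radw k (sqgap r theta x))%:E * G (x, sqgap r theta x)) * K.
Proof.
move=> k0 r0 mV unifV.
have [c c0 radE] := @radial_law R k k0.
(* [rho t] carries a point of squared norm [t] to the sphere of radius [r]. *)
pose rho (t : R) : R := (r / Num.sqrt t)%R.
have rho_gt0 t : (0 < t)%R -> (0 < rho t)%R by move=> t0; rewrite divr_gt0// sqrtr_gt0.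
(* Rescaling [x] by [rho t] produces the Jacobian [rho t ^+ p] and, by [radwM], the factor
   [rho t ^+ k / rho t ^+ 2]; [m t] is the inverse of their product. *)
pose m (t : R) : R := (if 0 < t <= 1 then rho t ^+ 2 / rho t ^+ (p + k) else 0)%R.
have m0 t : (0 <= m t)%R.
  rewrite /m; case: ifPn => // /andP[t0 _].
  by rewrite divr_ge0// exprn_ge0// ltW// rho_gt0.
have mm : measurable_fun setT m by rewrite /m /rho; mfun.
exists ((\int[leb]_t (m t)%:E) * c).
  by rewrite mule_ge0//; apply: integral_ge0 => t _; rewrite lee_fin.
move=> G mG G0.
pose f (x : 'rV[R]_p) (t : R) := if (0 < sqnormv x + t <= 1)%R then
  G (theta + rho (sqnormv x + t) *: x, rho (sqnormv x + t) ^+ 2 * t)%R else 0.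
have mf d' (T : measurableType d') (a : T -> 'rV[R]_p) (b : T -> R) :
    measurable_fun setT a -> measurable_fun setT b -> measurable_fun setT (fun z => f (a z) (b z)).
  move=> ma mb; rewrite /f; apply: measurable_fun_ifT; [mfun| |mfun].
  by apply: (measurableT_comp mG); rewrite /rho; mfun.
have f0 x t : 0 <= f x t by rewrite /f; case: ifPn.
rewrite (uniform_on_sphere_integral (F := fun z => G (theta + r *: lsubmx z, r ^+ 2 * sqnormv (rsubmx z))%R) mV)//; last first.
  by apply: (measurableT_comp mG); mfun.
transitivity (\int[lebesgue_rV p]_x \int[lebesgue_rV k]_u f x (sqnormv u)).
  rewrite ge0_integral_row_mx; last 2 first.
  - apply: measurable_fun_ifT; [mfun| |mfun].
    by apply: (measurableT_comp mG); rewrite /enorm; mfun.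
  - by move=> x; case: ifPn.
  apply: eq_integral => x _; apply: eq_integral => u _.
  rewrite /f sqnormv_row_mx; case: ifPn => // /andP[q0 _].
  congr G; congr pair.
    by rewrite scale_row_mx row_mxKl scalerA /enorm sqnormv_row_mx.
  rewrite scale_row_mx row_mxKr sqnormvZ /enorm sqnormv_row_mx /rho mulrA; congr (_ * _)%R.
  by rewrite expr_div_n exprVn.
transitivity ((\int[lebesgue_rV p]_x \int[leb]_t ((radw k t)%:E * f x t)) * c).
  rewrite -ge0_integralZr//; last 2 first.
  - apply: ge0_measurable_integral; first by apply: emeasurable_funM; [mfun|apply: mf; mfun].
    by move=> x t; rewrite mule_ge0// lee_fin radw_ge0.
  - by move=> x _; apply: integral_ge0 => t _; rewrite mule_ge0// lee_fin radw_ge0.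
  by apply: eq_integral => x _; apply: (radE (f x)) => //; apply: mf; mfun.
rewrite muleA; congr (_ * _).
transitivity (\int[lebesgue_rV p]_x \int[leb]_t
    ((radw k (t - sqnormv x))%:E * f x (t - sqnormv x)%R)).
  apply: eq_integral => x _.
  rewrite (@ge0_integral_affine _ _ (- sqnormv x) 1)//; last 2 first.
  - by apply: emeasurable_funM; [mfun|apply: mf; mfun].
  - by move=> t; rewrite mule_ge0// lee_fin radw_ge0.
  by rewrite mul1e; apply: eq_integral => t _; rewrite mul1r addrC.
transitivity (\int[leb]_t \int[lebesgue_rV p]_x
    ((radw k (t - sqnormv x))%:E * f x (t - sqnormv x)%R)).
  apply: ge0_integral_swap.
    by apply: emeasurable_funM; [mfun|apply: mf; mfun].
  by move=> x t; rewrite mule_ge0// lee_fin radw_ge0.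
have mI : measurable_fun setT (fun x => (radw k (sqgap r theta x))%:E * G (x, sqgap r theta x)).
  by apply: emeasurable_funM; rewrite /sqgap; [mfun|apply: (measurableT_comp mG); mfun].
have I0 x : 0 <= (radw k (sqgap r theta x))%:E * G (x, sqgap r theta x).
  by rewrite mule_ge0// lee_fin radw_ge0.
rewrite muleC -ge0_integralZr//; last 3 first.
- by mfun.
- by move=> t _; rewrite lee_fin.
- by apply: integral_ge0 => x _.
apply: eq_integral => t _.
rewrite /m /f; under eq_integral => x _ do rewrite [(sqnormv x + _)%R]addrC subrK.
case: ifPn => [/andP[t0 t1]|_]; last first.
  by rewrite mul0e integral0_eq// => x _; rewrite mule0.
have rt0 := rho_gt0 _ t0.
rewrite (@ge0_integral_affine_rV _ _ _ theta (rho t))//.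
rewrite muleA -EFinM -ge0_integralZl//; last 2 first.
- exact: (measurableT_comp mI (measurable_affine_rV theta (rho t))).
- by rewrite lee_fin mulr_ge0 ?exprn_ge0 ?(ltW rt0)// divr_ge0// exprn_ge0// ltW.
apply: eq_integral => x _.
have sE : sqgap r theta (theta + rho t *: x) = (rho t ^+ 2 * (t - sqnormv x))%R.
  rewrite /sqgap [(theta + _)%R]addrC addrK sqnormvZ mulrBr; congr (_ - _)%R.
  by rewrite /rho expr_div_n sqr_sqrtr ?ltW// divfK// gt_eqF.
rewrite sE radwM// [RHS]muleA; congr (_ * _); rewrite -EFinM; congr EFin.
by rewrite exprD; field; rewrite !expf_neq0 ?gt_eqF.
Qed.

(** The case [G = 1] of [sphere_section_cone] writes the volume of the ball, which is finite and
    positive, as [I * K]. So neither factor is 0, and [K] cannot be infinite; dividing by the volume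
    normalizes the formula. *)
Lemma sphere_section p k (r : R) (theta : 'rV[R]_p) d (Om : measurableType d)
    (Q : probability Om R) (V : Om -> 'rV[R]_(p + k)) :
  (0 < k)%N -> (0 < r)%R -> measurable_fun setT V -> uniform_on_sphere Q V ->
  exists2 K : R, (0 < K)%R & forall G : 'rV[R]_p * R -> \bar R,
    measurable_fun setT G -> (forall y, 0 <= G y) ->
    \int[Q]_w G (theta + r *: lsubmx (V w), r ^+ 2 * sqnormv (rsubmx (V w)))%R =
    K%:E * \int[lebesgue_rV p]_x
      ((radw k (sqgap r theta x))%:E * G (x, sqgap r theta x)).
Proof.
move=> k0 r0 mV unifV.
have [K K0 KE] := sphere_section_cone theta k0 r0 mV unifV.
have w0 : 0 < lebesgue_rV (p + k) (unit_cone (setT : set 'rV[R]_(p + k))).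
  by apply: unit_cone_gt0; rewrite addn_gt0 k0 orbT.
have wy := @unit_cone_fin R (p + k).
have Q1 : \int[Q]_w cst 1 w = 1.
  by rewrite integral_cst// mul1e; exact: probability_setT.
pose I := \int[lebesgue_rV p]_x ((radw k (sqgap r theta x))%:E * 1).
set w := lebesgue_rV _ _ in w0 wy KE *.
have wE : w = I * K.
  by rewrite -[LHS]mule1 -Q1; exact: (KE (cst 1) (measurable_cst _) (fun=> lee01)).
have I0 : 0 <= I by apply: integral_ge0 => x _; rewrite mule1 lee_fin radw_ge0.
have wfin : w \is a fin_num by rewrite ge0_fin_numE// ltW.
have Kgt0 : 0 < K.
  by rewrite lt0e K0 andbT; apply: contraTneq w0 => K0'; rewrite wE K0' mule0 ltxx.
have Igt0 : 0 < I.
  by rewrite lt0e I0 andbT; apply: contraTneq w0 => I0'; rewrite wE I0' mul0e ltxx.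
have Ky : K < +oo.
  rewrite ltey; apply: contraTneq wy => Ky; rewrite wE Ky gt0_muley// ltxx//.
have Kfin : K \is a fin_num by rewrite ge0_fin_numE.
have w0' : (0 < fine w)%R by rewrite fine_gt0// w0 wy.
exists (fine K / fine w)%R; first by rewrite divr_gt0// fine_gt0// Kgt0 Ky.
move=> G mG G0; have := KE G mG G0.
set J := \int[_]_x _; set E := \int[_]_x _ => JE.
rewrite EFinM muleAC fineK// [_ * E]muleC -JE -[in w * J](fineK wfin).
by rewrite muleAC -EFinM divff ?mul1e// gt_eqF.
Qed.

End sphere.

(** * Approximation of powers by test functions *)

Section bump_function.
Context {R : realType}.
Implicit Types (e a y : R).

(* For e > 0 a smooth function on R, flat at 0, tending to y_+^a as e -> 0; the
   limit itself is the instance e = 0. *)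
Definition ebump e a y : R := if 0 < y then expR (a * ln y - e / y) else 0.

Lemma bump_ge0 e a y : 0 <= ebump e a y.
Proof. by rewrite /ebump; case: ifPn => // _; exact: expR_ge0. Qed.

Lemma bump_le0 e a y : y <= 0 -> ebump e a y = 0.
Proof. by rewrite /ebump leNgt => /negbTE ->. Qed.

Lemma bumpB1 e a y : 0 < y -> ebump e (a - 1) y = ebump e a y / y.
Proof.
move=> y0; rewrite /ebump y0 mulrBl mul1r addrAC expRD expRN lnK//.
Qed.

Lemma measurable_bump e a : measurable_fun setT (ebump e a).
Proof.
apply: measurable_fun_ifT => //; first exact: measurable_gt.
apply: measurableT_comp => //; apply: measurable_funB; last first.
  by apply: measurable_funM => //; exact: measurable_inv.
by apply: measurable_funM => //; exact: measurable_ln.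
Qed.

(** The exponential of [e / y] dominates the term of degree [n] of its series. *)
Lemma expRN_le_pow e y n : 0 < e -> 0 < y -> expR (- (e / y)) <= n`!%:R / e ^+ n * y ^+ n.
Proof.
move=> e0 y0; case: n => [|n].
  by rewrite fact0 expr0 divr1 mulr1 expR_le1 oppr_le0 divr_ge0// ltW.
have ey0 : 0 < e / y by rewrite divr_gt0.
rewrite expRN -[leRHS]invrK lef_pV2 ?posrE ?expR_gt0//; last first.
  by rewrite invr_gt0 mulr_gt0 ?exprn_gt0// divr_gt0 ?exprn_gt0// ltr0n fact_gt0.
apply: le_trans (expR_ge1Dxn n (ltW ey0)).
rewrite -[leLHS]add0r lerD// expr_div_n le_eqVlt; apply/orP; left; apply/eqP; field.
by rewrite !expf_neq0 ?gt_eqF// pnatr_eq0 -lt0n fact_gt0.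
Qed.

(** The exponent [a] may be negative, since repeated differentiation keeps lowering it. The
    exponential supplies [M] extra powers of [y] with [a + M >= 2], and [y <= 1] reduces the
    resulting power to the square. *)
Lemma bump_quadratic e a : 0 < e ->
  exists2 C, 0 <= C & forall y, y <= 1 -> `|ebump e a y| <= C * y ^+ 2.
Proof.
move=> e0; pose n := Num.truncn (`|2 - a|); pose M := n.+1.
have aM : 2 <= a + M%:R.
  rewrite addrC -lerBlDr; apply: (le_trans (ler_norm _)); apply: ltW.
  exact: truncnS_gt.
exists (M`!%:R / e ^+ M); first by rewrite divr_ge0// exprn_ge0// ltW.
move=> y y1; rewrite ger0_norm ?bump_ge0//.
have [y0|y0] := ltP 0 y; last first.
  by rewrite bump_le0// mulr_ge0 ?sqr_ge0// divr_ge0// exprn_ge0// ltW.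
rewrite /ebump y0 expRD.
apply: (@le_trans _ _ (expR (a * ln y) * (M`!%:R / e ^+ M * y ^+ M))).
  by rewrite ler_wpM2l ?expR_ge0// expRN_le_pow.
rewrite mulrCA ler_wpM2l//; first by rewrite divr_ge0// exprn_ge0// ltW.
rewrite -[in X in _ * X <= _](lnK y0) -[in X in _ <= X](lnK y0) -!expRM_natl -expRD ler_expR -mulrDl.
by rewrite ler_wnM2r// ln_le0.
Qed.

Lemma is_derive0_quadratic (f : R -> R) (C : R) : 0 <= C ->
  (forall y, y <= 1 -> `|f y| <= C * y ^+ 2) -> is_derive (0 : R) 1 f 0.
Proof.
move=> C0 fC.
have f0 : f 0 = 0.
  by apply/eqP; rewrite -normr_le0; apply: (le_trans (fC 0 ler01)); rewrite expr0n mulr0.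
have cf : (fun h : R => h^-1 *: ((f \o shift 0) (h *: 1) - f 0)) @ 0^' --> (0 : R).
  apply/cvgrPdist_lt => eps eps0.
  have eC : 0 < eps / (C + 1) by rewrite divr_gt0// ltr_wpDl.
  near=> h.
  have h0 : h != 0 by near: h; exact: nbhs_dnbhs_neq.
  have h1 : `|h| < 1.
    by near: h; apply: dnbhs0_lt.
  have he : `|h| < eps / (C + 1).
    by near: h; apply: dnbhs0_lt.
  rewrite sub0r normrN f0 subr0 /= addr0 /GRing.scale/= mulr1 normrM normfV.
  rewrite ltr_pdivrMl ?normr_gt0//.
  apply: (le_lt_trans (fC h _)); first by rewrite (le_trans (ler_norm _))// ltW.
  rewrite -[h ^+ 2](@real_normK _ h) ?num_real// expr2 mulrCA ltr_pM2l ?normr_gt0//.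
  apply: (@le_lt_trans _ _ ((C + 1) * `|h|)); first by rewrite ler_wpM2r// lerDl.
  by rewrite mulrC -ltr_pdivlMr// ltr_wpDl.
split; first by apply/cvg_ex; exists 0.
exact/cvg_lim.
Unshelve. all: by end_near. Qed.

(** Differentiating the exponent gives [a / y + e / y^2], and dividing by [y] lowers the exponent of
    the bump by one, so derivatives stay among bumps. At 0 the quadratic bound gives derivative
    0. *)
Lemma is_derive_bump e a y : 0 < e ->
  is_derive y 1 (ebump e a) (a * ebump e (a - 1) y + e * ebump e (a - 2) y).
Proof.
move=> e0.
have [y0|y0|->] := ltgtP y 0.
- rewrite !bump_le0 ?ltW// !mulr0 addr0.
  apply: (@near_eq_is_derive _ _ _ (cst 0)).
  by near=> z; rewrite bump_le0// ltW//; near: z; exact: lt_nbhsl.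
- have -> : a * ebump e (a - 1) y + e * ebump e (a - 2) y =
     expR (a * ln y - e / y) * (a * y^-1 - e * (- y ^- 2)).
    rewrite (_ : a - 2 = a - 1 - 1); last by ring.
    by rewrite !bumpB1// /ebump y0; field; rewrite gt_eqF.
  apply: (@near_eq_is_derive _ _ _ (expR \o (fun z => a * ln z - e / z))).
    near=> z; rewrite /ebump ifT//=; near: z; exact: lt_nbhsr.
  apply: is_derive1_comp.
  apply: is_deriveB.
    have := is_derive1_ln y0 => H. exact: is_deriveZ.
  have H := @is_deriveV _ id y 1 1 (lt0r_neq0 y0) (is_derive_id _ _).
  rewrite (_ : e * - y ^- 2 = e *: (- y ^- 2 *: 1)); last by rewrite /GRing.scale/= mulr1.
  exact: is_deriveZ.
- have [C C0 bC] := bump_quadratic a e0.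
  rewrite !bump_le0// !mulr0 addr0; exact: is_derive0_quadratic bC.
Unshelve. all: by end_near. Qed.

Lemma continuous_bump e a : 0 < e -> continuous (ebump e a).
Proof.
move=> e0 y; apply: differentiable_continuous; apply/derivable1_diffP.
by have [] := is_derive_bump a y e0.
Qed.

End bump_function.

Section directional.
Context {R : realType} {p : nat}.

(** Along a line the one-variable chain rule suffices to differentiate a bump of [sqgap]. *)
Lemma is_derive_line (f : 'rV[R]_p -> R) (x v : 'rV[R]_p) (l : R) :
  is_derive (0 : R) 1 (fun t : R => f (t *: v + x)) l -> is_derive x v f l.
Proof.
have E : (fun h : R => h^-1 *: ((f \o shift x) (h *: v) - f x)) =
    (fun h : R => h^-1 *: (((fun t : R => f (t *: v + x)) \o shift 0) (h *: 1) - f (0 *: v + x))).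
  by apply/funext => h /=; rewrite scale0r add0r addr0 -[h *: (1 : R)]/(h * 1) mulr1.
case=> [d v']; split.
- by rewrite /derivable E.
- by rewrite -v' /derive E.
Qed.


Lemma sqgap_line (r : R) (theta x : 'rV[R]_p) (i : 'I_p) (t : R) :
  sqgap r theta (t *: delta_mx 0 i + x) =
  sqgap r theta x - 2 * (x 0 i - theta 0 i) * t - t ^+ 2.
Proof.
rewrite /sqgap /sqnormv /dotv (bigD1 i)//= [in RHS](bigD1 i)//= !mxE !eqxx.
rewrite [X in r ^+ 2 - (_ + X)](eq_bigr (fun j => (x - theta) 0 j * (x - theta) 0 j)).
  by rewrite /=; ring.
by move=> j ji; rewrite !mxE (negbTE ji) andbF mulr0 add0r.
Qed.

Lemma is_derive_bump_sqgap (e a r : R) (theta x : 'rV[R]_p) (i : 'I_p) : 0 < e ->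
  is_derive x (delta_mx 0 i) (fun z => ebump e a (sqgap r theta z))
    ((a * ebump e (a - 1) (sqgap r theta x) + e * ebump e (a - 2) (sqgap r theta x)) *
     (- 2 * (x 0 i - theta 0 i))).
Proof.
move=> e0; apply: is_derive_line.
pose b := 2 * (x 0 i - theta 0 i).
rewrite (_ : (fun t => _) = ebump e a \o
    (fun t : R => sqgap r theta x - b * t - t ^+ 2)); last first.
  by apply/funext => t /=; rewrite sqgap_line.
apply: is_derive1_comp.
  rewrite mulr0 subr0 expr0n subr0; exact: is_derive_bump.
apply: is_derive_eq.
by rewrite /b /GRing.scale/=; ring.
Qed.

(* An algebra of functions containing the bumps and closed under partial
   derivatives, whence the smoothness of its elements. *)
Inductive bump_alg (r e : R) (theta : 'rV[R]_p) : ('rV[R]_p -> R) -> Prop :=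
| bump_alg_cst c : bump_alg r e theta (fun=> c)
| bump_alg_coord i : bump_alg r e theta (fun x => x 0 i)
| bump_alg_bump a : bump_alg r e theta (fun x => ebump e a (sqgap r theta x))
| bump_algD f g : bump_alg r e theta f -> bump_alg r e theta g ->
    bump_alg r e theta (fun x => f x + g x)
| bump_algM f g : bump_alg r e theta f -> bump_alg r e theta g ->
    bump_alg r e theta (fun x => f x * g x).

Lemma bump_alg_is_derive r e theta f (i : 'I_p) : 0 < e -> bump_alg r e theta f ->
  exists2 f', bump_alg r e theta f' & forall x, is_derive x (delta_mx 0 i) f (f' x).
Proof.
move=> e0; elim=> {f} [c|j|a|f g _ [f' Bf' df] _ [g' Bg' dg]|f g Bf [f' Bf' df] Bg [g' Bg' dg]].
- exists (fun=> 0); first exact: bump_alg_cst.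
  by move=> x; exact: is_derive_cst.
- exists (fun=> (i == j)%:R); first exact: bump_alg_cst.
  move=> x; apply: is_derive_line.
  rewrite (_ : (fun t => _) = (fun t : R => t * (i == j)%:R + x 0 j)); last first.
    by apply/funext => t; rewrite !mxE eqxx/= [j == i]eq_sym.
  by apply: is_derive_eq; rewrite /GRing.scale/=; ring.
- exists (fun x => (a * ebump e (a - 1) (sqgap r theta x) +
      e * ebump e (a - 2) (sqgap r theta x)) * (- 2 * (x 0 i + - theta 0 i))).
    apply: bump_algM.
      apply: bump_algD; apply: bump_algM; try exact: bump_alg_cst; exact: bump_alg_bump.
    apply: bump_algM; first exact: bump_alg_cst.
    by apply: bump_algD; [exact: bump_alg_coord|exact: bump_alg_cst].
  by move=> x; exact: is_derive_bump_sqgap.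
- exists (fun x => f' x + g' x); first exact: bump_algD.
  by move=> x; exact: is_deriveD.
- exists (fun x => f x * g' x + g x * f' x).
    by apply: bump_algD; exact: bump_algM.
  by move=> x; exact: is_deriveM.
Qed.

Lemma continuous_sqgap r theta : continuous (@sqgap R p r theta).
Proof.
pose q i (t : R) := (t - theta 0 i) * (t - theta 0 i).
have cq i : continuous (q i).
  by move=> t; apply: cvgM; apply: cvgB; (exact: cvg_id || exact: cvg_cst).
rewrite (_ : sqgap r theta = (fun t : R => r ^+ 2 - t) \o
    (fun x : 'rV[R]_p => \sum_i q i (x 0 i))); last first.
  apply/funext => x; rewrite /= /sqgap /sqnormv /dotv; congr (_ - _).
  by apply: eq_bigr => i _; rewrite !mxE.
move=> x; apply: continuous_comp; last first.
  by apply: cvgB; [exact: cvg_cst|exact: cvg_id].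
move: x; apply: continuous_big; first exact: add_continuous.
move=> i _ x; apply: (@continuous_comp _ _ _ (fun z : 'rV[R]_p => z 0 i) (q i)).
  exact: coord_continuous.
exact: cq.
Qed.

Lemma bump_alg_continuous r e theta f : 0 < e -> bump_alg r e theta f -> continuous f.
Proof.
move=> e0; elim=> {f} [c|j|a|f g _ cf _ cg|f g _ cf _ cg] x.
- exact: cst_continuous.
- exact: coord_continuous.
- apply: (@continuous_comp _ _ _ (sqgap r theta) (ebump e a)).
    exact: continuous_sqgap.
  exact: continuous_bump.
- by apply: continuousD; [exact: cf|exact: cg].
- by apply: continuousM; [exact: cf|exact: cg].
Qed.

Lemma bump_alg_smooth r e theta f : 0 < e -> bump_alg r e theta f -> smooth f.
Proof.
move=> e0 Bf s.
suff Bs : bump_alg r e theta (iter_partial s f).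
  split; first exact: bump_alg_continuous Bs.
  move=> x i; have [f' _ df] := bump_alg_is_derive i e0 Bs.
  by have [] := df x.
elim: s => //= i s IH; have [f' Bf' df] := bump_alg_is_derive i e0 IH.
rewrite (_ : partial i _ = f')//; apply/funext => x.
by rewrite /partial; have [_ ->] := df x.
Qed.

End directional.

(** * Uniform bounds and limits of the bumps as e tends to 0 *)

Section bump_limit.
Context {R : realType}.
Implicit Types (e a y t : R).

Lemma bump0E e a y : ebump e a y = ebump 0 a y * expR (- (e / y)).
Proof.
rewrite /ebump; case: ifPn => y0; last by rewrite mul0r.
by rewrite mul0r subr0 expRD.
Qed.

(** For [e > 0] this is the derivative of [ebump e a], by [is_derive_bump]; likewise [ddbump] below
    is the second derivative. *)
Definition dbump e a y := a * ebump e (a - 1) y + e * ebump e (a - 2) y.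

Lemma dbump0E e a y : dbump e a y = ebump 0 (a - 1) y * ((a + e / y) * expR (- (e / y))).
Proof.
have [y0|y0] := ltP 0 y; last by rewrite /dbump !bump_le0// !mulr0 addr0 mul0r.
rewrite /dbump (_ : a - 2 = a - 1 - 1); last by ring.
rewrite [ebump e (a - 1 - 1) y]bumpB1// [ebump e (a - 1) y]bump0E; field.
by rewrite gt_eqF.
Qed.

Definition ddbump e a y := a * dbump e (a - 1) y + e * dbump e (a - 2) y.

Lemma ddbump0E e a y : ddbump e a y = ebump 0 (a - 2) y *
  ((a * (a - 1) + (2 * a - 2) * (e / y) + (e / y) ^+ 2) * expR (- (e / y))).
Proof.
have [y0|y0] := ltP 0 y; last first.
  by rewrite /ddbump !dbump0E !bump_le0// !mul0r !mulr0 addr0.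
rewrite /ddbump !dbump0E (_ : a - 1 - 1 = a - 2); last by ring.
rewrite [ebump 0 (a - 2 - 1) y]bumpB1//; field.
by rewrite gt_eqF.
Qed.

Lemma expRN_mul_le1 t : 0 <= t -> t * expR (- t) <= 1.
Proof.
move=> t0; rewrite expRN ler_pdivrMr ?expR_gt0// mul1r.
by apply: le_trans (expR_ge1Dx t); rewrite lerDr.
Qed.

Lemma expRN_mul_le2 t : 0 <= t -> t ^+ 2 * expR (- t) <= 2.
Proof.
move=> t0; rewrite expRN ler_pdivrMr ?expR_gt0// -ler_pdivrMl//.
by apply: le_trans (expR_ge1Dxn 1 t0); rewrite mulrC lerDr.
Qed.

Lemma quadratic_expRN_bound (a b c t : R) : 0 <= t ->
  `|(a + b * t + c * t ^+ 2) * expR (- t)| <= `|a| + `|b| + 2 * `|c|.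
Proof.
move=> t0; rewrite (mulrDl (a + b * t)) (mulrDl a).
have e1 : expR (- t) <= 1 by rewrite expR_le1 oppr_le0.
have e0 := expR_ge0 (- t).
apply: (le_trans (ler_normD _ _)); apply: lerD; last first.
  rewrite -mulrA normrM [leRHS]mulrC ler_wpM2l// ger0_norm ?expRN_mul_le2//.
  by rewrite mulr_ge0// sqr_ge0.
apply: (le_trans (ler_normD _ _)); apply: lerD.
  by rewrite normrM -[leRHS]mulr1 ler_wpM2l// ger0_norm.
rewrite -mulrA normrM -[leRHS]mulr1 ler_wpM2l// ger0_norm ?expRN_mul_le1//.
by rewrite mulr_ge0.
Qed.

Lemma quadratic_expRN_cvg (a b c y : R) :
  (a + b * (n.+1%:R^-1 / y) + c * (n.+1%:R^-1 / y) ^+ 2) *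
    expR (- (n.+1%:R^-1 / y)) @[n --> \oo] --> a.
Proof.
have t0 : (n.+1%:R^-1 / y) @[n --> \oo] --> (0 : R).
  rewrite -[X in _ --> X](mul0r y^-1); apply: cvgMl.
  exact: cvg_harmonic.
rewrite -[X in _ --> X](_ : (a + b * 0 + c * (0 * 0)) * expR (- 0) = a); last first.
  by rewrite oppr0 expR0 !mulr0 !addr0 mulr1.
apply: cvgM.
  apply: cvgD; last by apply: cvgM; [exact: cvg_cst|apply: cvgM].
  by apply: cvgD; [exact: cvg_cst|apply: cvgM => //; exact: cvg_cst].
apply: (@cvg_comp _ _ _ _ expR _ (nbhs (- 0 : R))).
  exact: cvgN.
exact: continuous_expR.
Qed.

Lemma bump0_le (a y z : R) : 0 <= a -> 0 < z -> y <= z -> ebump 0 a y <= ebump 0 a z.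
Proof.
move=> a0 z0 yz; have [y0|y0] := ltP 0 y; last by rewrite bump_le0// bump_ge0.
rewrite /ebump y0 z0 !mul0r !subr0 ler_expR ler_wpM2l// ler_ln ?posrE//.
Qed.

End bump_limit.

Section dominated.
Context {R : realType} {p : nat}.
Local Notation mu := (@lebesgue_rV R p).
Implicit Types (f h : 'rV[R]_p -> R) (K : set 'rV[R]_p).

Lemma locally_integrableM f h K C : locally_integrable_rV f -> compact K -> measurable K ->
  measurable_fun setT h -> (forall x, `|h x| <= C) -> (forall x, ~ K x -> h x = 0) ->
  mu.-integrable setT (EFin \o (fun x => f x * h x)).
Proof.
move=> [mf If] cK mK mh hC h0.
have C0 : 0 <= C by apply: le_trans (hC 0).
have fK : mu.-integrable K (EFin \o f).
  apply/integrableP; split; last exact: If.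
  by apply/measurable_EFinP; exact: measurable_funTS.
have gint : mu.-integrable setT ((fun x => C%:E * (f x)%:E)%E \_ K).
  by apply/(integrable_mkcond _ mK); exact: integrableZl.
apply: (le_integrable _ _ _ gint) => //.
  by apply/measurable_EFinP; exact: measurable_funM.
move=> x _; rewrite patchE; case: ifPn => [_|].
  rewrite -EFinM !abse_EFin lee_fin !normrM mulrC ler_wpM2r//.
  by rewrite [leRHS]ger0_norm.
by rewrite notin_setE => Kx; rewrite /= h0// mulr0.
Qed.

(** The dominating function is [C * |f|] on [K] and 0 elsewhere; a common compact [K] is needed
    because [f] is only locally integrable. *)
Lemma dominated_locally_integrable f K C (h_ : nat -> 'rV[R]_p -> R) h :
  locally_integrable_rV f -> compact K -> measurable K ->
  (forall n, measurable_fun setT (h_ n)) -> measurable_fun setT h ->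
  (forall n x, `|h_ n x| <= C) -> (forall n x, ~ K x -> h_ n x = 0) ->
  (forall x, h_ n x @[n --> \oo] --> h x) ->
  \int[mu]_x (f x * h_ n x) @[n --> \oo] --> \int[mu]_x (f x * h x).
Proof.
move=> lf cK mK mh_ mh h_C h_0 h_h.
have [mf _] := lf.
have C0 : 0 <= C by apply: le_trans (h_C 0%N 0).
have KC x : `|if x \in K then C else 0| <= C by case: ifPn; rewrite ?ger0_norm// normr0.
have gint : mu.-integrable setT (EFin \o (fun x => f x * (if x \in K then C else 0))).
  apply: (locally_integrableM lf cK mK _ KC).
    rewrite (_ : (fun x => _) = (fun x => C * \1_K x)).
      by apply: measurable_funM => //; exact: measurable_indic.
    by apply/funext => x; rewrite indicE; case: ifPn; rewrite ?mulr1 ?mulr0.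
  by move=> x Kx; rewrite memNset.
have gint' := integrable_abse gint.
have [] := @dominated_convergence _ _ _ mu setT measurableT
  (fun n => EFin \o (fun x => f x * h_ n x)) (EFin \o (fun x => f x * h x))
  (abse \o (EFin \o (fun x => f x * (if x \in K then C else 0)))).
- by move=> n; apply/measurable_EFinP; exact: measurable_funM.
- by apply/measurable_EFinP; exact: measurable_funM.
- apply: aeW => x _; apply/cvg_EFin; first by apply: nearW.
  by apply: cvgM; [exact: cvg_cst|exact: h_h].
- exact: gint'.
- apply: aeW => x n _; rewrite /= lee_fin !normrM ler_wpM2l//.
  case: ifPn => [_|]; first by rewrite [leRHS]ger0_norm.
  by rewrite notin_setE => Kx; rewrite h_0.
move=> ifh _ cv; apply: fine_cvg.
by rewrite fineK//; apply: integrable_fin_num.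
Qed.

Lemma Rintegral_sum I (s : seq I) (f : I -> 'rV[R]_p -> R) :
  (forall i, mu.-integrable setT (EFin \o f i)) ->
  \int[mu]_x (\sum_(i <- s) f i x) = \sum_(i <- s) \int[mu]_x f i x.
Proof.
move=> fi; elim: s => [|i s IH].
  rewrite big_nil /Rintegral integral0_eq// => x _; by rewrite big_nil.
rewrite big_cons -IH -RintegralD//.
- by apply: eq_Rintegral => x _; rewrite big_cons.
- rewrite (_ : EFin \o _ = (fun x => \sum_(j <- s) (EFin \o f j) x)%E).
    by apply: integrable_sum => // j _; exact: fi.
  by apply/funext => x /=; rewrite sumEFin.
Qed.

End dominated.

(** * Integration by parts *)

Section weak_identities.
Context {R : realType} {p : nat}.
Variables (r a : R) (theta : 'rV[R]_p).
Hypotheses (r0 : 0 < r) (a2 : 2 <= a).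
Local Notation mu := (@lebesgue_rV R p).
Local Notation s := (sqgap r theta).
Implicit Types (f h w : 'rV[R]_p -> R) (F : 'rV[R]_p -> 'rV[R]_p).
Implicit Types (b c e y A B C W : R).

Lemma sqr_coord_le (x : 'rV[R]_p) i : x 0 i ^+ 2 <= sqnormv x.
Proof.
rewrite /sqnormv /dotv (bigD1 i)//= -expr2 lerDl.
by apply: sumr_ge0 => j _; rewrite -expr2 sqr_ge0.
Qed.

Lemma sqgap_gt0_coord x i : 0 < s x -> `|x 0 i - theta 0 i| <= r.
Proof.
rewrite subr_gt0 => /ltW sx.
rewrite -(@ler_sqr R) ?nnegrE ?(ltW r0)// real_normK ?num_real//.
apply: le_trans sx; have := sqr_coord_le (x - theta) i.
by rewrite !mxE.
Qed.

Lemma sqgap_le_sqr x : s x <= r ^+ 2.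
Proof. by rewrite gerBl sqnormv_ge0. Qed.

(** A cube of half-side [r] around [theta] replaces the ball: as a product of segments it is at once
    compact and measurable. *)
Lemma sqgap_support : exists K : set 'rV[R]_p,
  [/\ compact K, measurable K & forall x, ~ K x -> s x <= 0].
Proof.
pose A (i : 'I_p) : set R := `[theta 0 i - r, theta 0 i + r]%classic.
have mA i : measurable (A i) by exact: measurable_itv.
exists [set x : 'rV[R]_p | forall i, A i (x 0 i)]; split.
- by apply: rV_compact => i; exact: segment_compact.
- exact: (measurable_rV_box mA).
move=> x; apply: contra_notP => /negP; rewrite -ltNge => sx i.
by have := sqgap_gt0_coord i sx; rewrite ler_distl /A/= in_itv/=.
Qed.

Lemma bump_alg_test e f : 0 < e -> bump_alg r e theta f ->
  (forall x, s x <= 0 -> f x = 0) -> test_function f.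
Proof.
move=> e0 Bf f0; split; first exact: bump_alg_smooth Bf.
by have [K [cK _ K0]] := sqgap_support; exists K => // x /K0/f0.
Qed.

Let grad e i (x : 'rV[R]_p) := dbump e a (s x) * (- 2 * (x 0 i - theta 0 i)).
(** Only pure second derivatives occur, since the Laplacian is handled coordinate by coordinate. *)
Let hess e i (x : 'rV[R]_p) :=
  ddbump e a (s x) * (4 * (x 0 i - theta 0 i) ^+ 2) + dbump e a (s x) * (- 2).

Let partial_bump e i : 0 < e ->
  partial i (fun x => ebump e a (s x)) = grad e i.
Proof.
move=> e0; apply/funext => x; rewrite /partial.
by have [_ ->] := is_derive_bump_sqgap a r theta x i e0.
Qed.

Let bump_alg_dbump e b : bump_alg r e theta (fun x => dbump e b (s x)).
Proof.
apply: bump_algD; apply: bump_algM; try exact: bump_alg_cst; exact: bump_alg_bump.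
Qed.

Let partial_grad e i : 0 < e -> partial i (grad e i) = hess e i.
Proof.
move=> e0; apply/funext => x; rewrite /partial.
have d1 b := is_derive_bump_sqgap b r theta x i e0.
have dD : is_derive x (delta_mx 0 i) (fun z : 'rV[R]_p => - 2 * (z 0 i - theta 0 i)) (- 2 : R).
  apply: is_derive_line.
  rewrite (_ : (fun t => _) = (fun t : R => - 2 * t + - 2 * (x 0 i - theta 0 i))).
    by apply: is_derive_eq; rewrite /GRing.scale/=; ring.
  by apply/funext => t; rewrite !mxE !eqxx/=; ring.
have dd : is_derive x (delta_mx 0 i) (fun z => dbump e a (s z))
   (ddbump e a (s x) * (- 2 * (x 0 i - theta 0 i))).
  have d3 b c := is_deriveZ c (d1 b).
  apply: (is_derive_eq (is_deriveD (d3 (a - 1) a) (d3 (a - 2) e))).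
  by rewrite /ddbump /dbump /GRing.scale/=; ring.
have [_ ->] := is_deriveM dd dD.
by rewrite /hess /GRing.scale/=; ring.
Qed.

Let test_bump e : 0 < e -> test_function (fun x => ebump e a (s x)).
Proof.
move=> e0; apply: (bump_alg_test e0); first exact: bump_alg_bump.
by move=> x sx; rewrite bump_le0.
Qed.

Let dbump_le0 e b y : y <= 0 -> dbump e b y = 0.
Proof. by move=> y0; rewrite /dbump !bump_le0// !mulr0 addr0. Qed.

Let test_grad e i : 0 < e -> test_function (grad e i).
Proof.
move=> e0; apply: (bump_alg_test e0).
  apply: bump_algM; first exact: bump_alg_dbump.
  apply: bump_algM; first exact: bump_alg_cst.
  by apply: bump_algD; [exact: bump_alg_coord|exact: bump_alg_cst].
by move=> x sx; rewrite /grad dbump_le0// mul0r.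
Qed.

(* With t = e / s x, ebump, dbump and ddbump all have the shape
   ebump 0 c (s x) * (A + B t + C t^2) exp(-t), which is bounded uniformly in
   e >= 0 and tends to A * ebump 0 c (s x). *)
Let prof c A B C w (e : R) (x : 'rV[R]_p) :=
  ebump 0 c (s x) * ((A + B * (e / s x) + C * (e / s x) ^+ 2) * expR (- (e / s x))) * w x.

Let gradE e i x : grad e i x =
  prof (a - 1) a 1 0 (fun z => - 2 * (z 0 i - theta 0 i)) e x.
Proof. by rewrite /grad /prof dbump0E mul0r addr0 mul1r. Qed.

Let hessE e i x : hess e i x =
  prof (a - 2) (a * (a - 1)) (2 * a - 2) 1 (fun z => 4 * (z 0 i - theta 0 i) ^+ 2) e x +
  prof (a - 1) a 1 0 (fun=> - 2) e x.
Proof. by rewrite /hess /prof dbump0E ddbump0E mul0r addr0 !mul1r. Qed.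

Let measurable_prof c A B C w e : measurable_fun setT w -> measurable_fun setT (prof c A B C w e).
Proof.
have ms := @measurable_sqgap R p r theta.
have mes : measurable_fun setT (fun x => e / s x).
  by apply: measurable_funM => //; exact: measurable_funV.
move=> mw; rewrite /prof; apply: measurable_funM => //.
apply: measurable_funM; first exact: (measurableT_comp (measurable_bump 0 c)).
apply: measurable_funM; last first.
  by apply: measurableT_comp => //; exact: measurable_oppr.
apply: measurable_funD.
  by apply: measurable_funD => //; exact: measurable_funM.
by apply: measurable_funM => //; exact: measurable_funX.
Qed.

Let prof_bound c A B C w W e x : 0 <= c -> 0 <= e -> (forall x, 0 < s x -> `|w x| <= W) ->
  `|prof c A B C w e x| <= ebump 0 c (r ^+ 2) * (`|A| + `|B| + 2 * `|C|) * `|W|.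
Proof.
move=> c0 e0 wW; have [sx|sx] := ltP 0 (s x); last first.
  by rewrite /prof bump_le0// !mul0r normr0 !mulr_ge0// ?bump_ge0// !addr_ge0// mulr_ge0.
rewrite /prof !normrM -normrM ler_pM// ?mulr_ge0//.
  rewrite ler_pM//; last by rewrite quadratic_expRN_bound// divr_ge0// ltW.
  by rewrite ger0_norm ?bump_ge0// bump0_le ?exprn_gt0// sqgap_le_sqr.
by rewrite (le_trans (wW x sx))// ler_norm.
Qed.

Let prof_out c A B C w e x : s x <= 0 -> prof c A B C w e x = 0.
Proof. by move=> sx; rewrite /prof bump_le0// !mul0r. Qed.

Let prof_integrable f c A B C w W e : locally_integrable_rV f -> 0 <= c -> 0 <= e ->
  measurable_fun setT w -> (forall x, 0 < s x -> `|w x| <= W) ->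
  mu.-integrable setT (EFin \o (fun x => f x * prof c A B C w e x)).
Proof.
move=> lf c0 e0 mw wW; have [K [cK mK K0]] := sqgap_support.
apply: (locally_integrableM lf cK mK).
- exact: measurable_prof.
- by move=> x; exact: prof_bound wW.
- by move=> x /K0; exact: prof_out.
Qed.

Let prof0 c A B C w x : prof c A B C w 0 x = ebump 0 c (s x) * A * w x.
Proof. by rewrite /prof mul0r oppr0 expR0 expr0n/= !mulr0 !addr0 mulr1. Qed.

Let prof_cvg f c A B C w W : locally_integrable_rV f -> 0 <= c ->
  measurable_fun setT w -> (forall x, 0 < s x -> `|w x| <= W) ->
  \int[mu]_x (f x * prof c A B C w n.+1%:R^-1 x) @[n --> \oo] -->
  \int[mu]_x (f x * prof c A B C w 0 x).
Proof.
move=> lf c0 mw wW; have [K [cK mK K0]] := sqgap_support.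
apply: (dominated_locally_integrable lf cK mK).
- by move=> n; exact: measurable_prof.
- exact: measurable_prof.
- by move=> n x; apply: (prof_bound _ _ _ _ _ _ wW) => //; rewrite invr_ge0.
- by move=> n x /K0; exact: prof_out.
- move=> x; rewrite prof0 /prof; apply: cvgM; last exact: cvg_cst.
  apply: cvgM; first exact: cvg_cst.
  exact: quadratic_expRN_cvg.
Qed.

(** [2 <= a] keeps the exponents [a], [a - 1] and [a - 2] nonnegative, so that by [prof_bound] the
    profiles stay bounded near the sphere down to [e = 0]. *)
Let a0 : 0 <= a. Proof. by apply: le_trans a2. Qed.
Let a1 : 0 <= a - 1. Proof. by rewrite subr_ge0 (le_trans _ a2)// ler1n. Qed.
Let a20 : 0 <= a - 2. Proof. by rewrite subr_ge0. Qed.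

Let mcoord i : measurable_fun setT (fun z : 'rV[R]_p => z 0 i - theta 0 i).
Proof. by apply: measurable_funB => //; exact: measurable_coord. Qed.

Let mw1 i : measurable_fun setT (fun z : 'rV[R]_p => - 2 * (z 0 i - theta 0 i)).
Proof. exact: measurable_funM. Qed.

Let mw2 i : measurable_fun setT (fun z : 'rV[R]_p => 4 * (z 0 i - theta 0 i) ^+ 2).
Proof. by apply: measurable_funM => //; exact: measurable_funX. Qed.

Let w1 i x : 0 < s x -> `|- 2 * (x 0 i - theta 0 i)| <= 2 * r.
Proof. by move=> sx; rewrite normrM normrN normr_nat ler_wpM2l// sqgap_gt0_coord. Qed.

Let w2 i x : 0 < s x -> `|4 * (x 0 i - theta 0 i) ^+ 2| <= 4 * r ^+ 2.
Proof.
move=> sx; rewrite normrM normr_nat ler_wpM2l// normrX.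
by rewrite lerXn2r ?nnegrE// ?(ltW r0)// sqgap_gt0_coord.
Qed.

Lemma integrable_bump f : locally_integrable_rV f ->
  mu.-integrable setT (EFin \o (fun x => f x * ebump 0 a (s x))).
Proof.
move=> lf; have := @prof_integrable f a 1 0 0 (fun=> 1) 1 0 lf a0 (lexx _) (measurable_cst _).
by under eq_fun do rewrite prof0 !mulr1; apply=> x _; rewrite normr1.
Qed.

(** The weight is the limit of [grad] as [e] tends to 0, that is, the partial derivative of [s_+^a];
    the weight of the next lemma is the limit of [hess]. *)
Lemma integrable_bump_grad f i : locally_integrable_rV f ->
  mu.-integrable setT (EFin \o
    (fun x => f x * (- 2 * a * ebump 0 (a - 1) (s x) * (x 0 i - theta 0 i)))).
Proof.
move=> lf; have := @prof_integrable f (a - 1) a 1 0 _ _ 0 lf a1 (lexx _) (mw1 i) (@w1 i).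
apply: eq_integrable => // x _ /=; rewrite prof0; congr EFin; ring.
Qed.

Lemma integrable_bump_hess f i : locally_integrable_rV f ->
  mu.-integrable setT (EFin \o (fun x => f x *
    (4 * a * (a - 1) * ebump 0 (a - 2) (s x) * (x 0 i - theta 0 i) ^+ 2 -
     2 * a * ebump 0 (a - 1) (s x)))).
Proof.
move=> lf.
have := integrableD measurableT
  (@prof_integrable f (a - 2) (a * (a - 1)) (2 * a - 2) 1 _ _ 0 lf a20 (lexx _) (mw2 i) (@w2 i))
  (@prof_integrable f (a - 1) a 1 0 (fun=> - 2) 2 0 lf a1 (lexx _) (measurable_cst _) _).
rewrite normrN normr_nat => /(_ (fun _ _ => lexx _)).
apply: eq_integrable => // x _ /=; rewrite !prof0; congr EFin; ring.
Qed.

Let en0 n : 0 < (n.+1%:R^-1 : R). Proof. by rewrite invr_gt0. Qed.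

(** The sum is kept at positive [e], where [grad] is still a test function: for the Laplacian, a
    second integration by parts has to take place before the limit. *)
Let div_cvg F h : is_weak_div F h ->
  (\sum_i \int[mu]_x (F x 0 i * grad n.+1%:R^-1 i x)) @[n --> \oo] -->
  - \int[mu]_x (h x * ebump 0 a (s x)).
Proof.
case=> lF lh FE.
have E n : \sum_i \int[mu]_x (F x 0 i * grad n.+1%:R^-1 i x) =
    - \int[mu]_x (h x * prof a 1 0 0 (fun=> 1) n.+1%:R^-1 x).
  rewrite -Rintegral_sum; last first.
    move=> i; have := @prof_integrable _ (a - 1) a 1 0 _ _ n.+1%:R^-1 (lF i) a1 (ltW (en0 n)) (mw1 i) (@w1 i).
    by apply: eq_integrable => // x _ /=; rewrite gradE.
  have := FE _ (test_bump (en0 n)).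
  rewrite (_ : (fun x => dotv _ _) = (fun x => \sum_i F x 0 i * grad n.+1%:R^-1 i x)); last first.
    by apply/funext => x; apply: eq_bigr => i _; rewrite mxE partial_bump.
  move=> ->; congr (- Rintegral _ _ _); apply/funext => x.
  by rewrite /prof bump0E !mul0r !addr0 mul1r mulr1.
under eq_fun do rewrite E.
apply: cvgN; rewrite [X in _ --> X](_ : _ = \int[mu]_x (h x * prof a 1 0 0 (fun=> 1) 0 x)).
  by apply: (@prof_cvg _ _ _ _ _ _ 1) => // x _; rewrite normr1.
by apply: eq_Rintegral => x _; rewrite prof0 !mulr1.
Qed.

Lemma weak_div_bump F h : is_weak_div F h ->
  \sum_i \int[mu]_x (F x 0 i * (- 2 * a * ebump 0 (a - 1) (s x) * (x 0 i - theta 0 i))) =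
  - \int[mu]_x (h x * ebump 0 a (s x)).
Proof.
move=> dF; have [lF lh _] := dF.
apply: (@cvg_unique _ _ _ _ _ _ _ (div_cvg dF)) => //.
apply: cvg_big; first exact: add_continuous.
move=> i _.
rewrite [X in _ --> X](_ : _ = \int[mu]_x (F x 0 i *
    prof (a - 1) a 1 0 (fun z => - 2 * (z 0 i - theta 0 i)) 0 x)); last first.
  by apply: eq_Rintegral => x _; rewrite prof0; congr (_ * _); ring.
under eq_fun do under eq_Rintegral do rewrite gradE.
exact: (@prof_cvg _ _ a 1 0 _ _ (lF i) a1 (mw1 i) (@w1 i)).
Qed.

(** Both limits concern one sequence: [div_cvg] for the weak gradient [F] gives the right-hand side,
    and testing each [F_i] against [grad e i] moves the remaining derivative from [f] to the
    bump. *)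
Lemma weak_laplacian_bump f h : is_weak_laplacian f h ->
  \sum_i \int[mu]_x (f x *
    (4 * a * (a - 1) * ebump 0 (a - 2) (s x) * (x 0 i - theta 0 i) ^+ 2 -
     2 * a * ebump 0 (a - 1) (s x))) =
  \int[mu]_x (h x * ebump 0 a (s x)).
Proof.
case=> F gF dF.
have := div_cvg dF => /cvgN; rewrite opprK => cF.
apply: (@cvg_unique _ _ _ _ _ _ _ cF) => //.
have -> : (- (fun n => \sum_i \int[mu]_x (F x 0 i * grad n.+1%:R^-1 i x))) =
    (fun n => \sum_i \int[mu]_x (f x * hess n.+1%:R^-1 i x)).
  apply/funext => n; rewrite -[LHS]sumrN; apply: eq_bigr => i _.
  have [_ _ /(_ _ (test_grad i (en0 n)))] := gF i.
  by rewrite partial_grad// => ->.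
apply: cvg_big; first exact: add_continuous.
move=> i _; have [lf _ _] := gF i.
have c1 := @prof_cvg f (a - 2) (a * (a - 1)) (2 * a - 2) 1 _ _ lf a20 (mw2 i) (@w2 i).
have c2 : \int[mu]_x (f x * prof (a - 1) a 1 0 (fun=> - 2) n.+1%:R^-1 x) @[n --> \oo] -->
    \int[mu]_x (f x * prof (a - 1) a 1 0 (fun=> - 2) 0 x).
  by apply: (@prof_cvg _ _ _ _ _ _ 2) => // x _; rewrite normrN normr_nat.
have i2 e : 0 <= e -> mu.-integrable setT (EFin \o (fun x => f x * prof (a - 1) a 1 0 (fun=> - 2) e x)).
  by move=> e0; apply: (@prof_integrable _ _ _ _ _ _ 2) => // x _; rewrite normrN normr_nat.
pose w4 (z : 'rV[R]_p) := 4 * (z 0 i - theta 0 i) ^+ 2.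
have i1 e : 0 <= e -> mu.-integrable setT (EFin \o
    (fun x => f x * prof (a - 2) (a * (a - 1)) (2 * a - 2) 1 w4 e x)).
  move=> e0.
  exact: (@prof_integrable f (a - 2) (a * (a - 1)) (2 * a - 2) 1 _ _ e lf a20 e0 (mw2 i) (@w2 i)).
have hessD n : \int[mu]_x (f x * hess n.+1%:R^-1 i x) =
    \int[mu]_x (f x * prof (a - 2) (a * (a - 1)) (2 * a - 2) 1 w4 n.+1%:R^-1 x) +
    \int[mu]_x (f x * prof (a - 1) a 1 0 (fun=> - 2) n.+1%:R^-1 x).
  rewrite -RintegralD//; [|exact: i1 (ltW (en0 n))|exact: i2 (ltW (en0 n))].
  by apply: eq_Rintegral => x _; rewrite hessE mulrDr.
have <- : \int[mu]_x (f x * prof (a - 2) (a * (a - 1)) (2 * a - 2) 1 w4 0 x) +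
    \int[mu]_x (f x * prof (a - 1) a 1 0 (fun=> - 2) 0 x) = \int[mu]_x (f x *
    (4 * a * (a - 1) * ebump 0 (a - 2) (s x) * (x 0 i - theta 0 i) ^+ 2 -
     2 * a * ebump 0 (a - 1) (s x))).
  rewrite -RintegralD//; [|exact: i1|exact: i2].
  by apply: eq_Rintegral => x _; rewrite !prof0 /w4; ring.
have -> : (fun n => \int[mu]_x (f x * hess n.+1%:R^-1 i x)) = (fun n =>
    \int[mu]_x (f x * prof (a - 2) (a * (a - 1)) (2 * a - 2) 1 w4 n.+1%:R^-1 x) +
    \int[mu]_x (f x * prof (a - 1) a 1 0 (fun=> - 2) n.+1%:R^-1 x)).
  exact/funext.
exact: cvgD.
Qed.

End weak_identities.

(** * Comparison of the risks given the radius *)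

Section radial_weight.
Context {R : realType}.

(** [radw k] is the power [k/2 - 1], and [k/2 - 1 + (j + 1) = k/2 + j]. *)
Lemma ebump_radw k j (y : R) : ebump 0 ((k + j.*2)%:R / 2) y = radw k y * y ^+ j.+1.
Proof.
have [y0|y0] := ltP 0 y; last by rewrite bump_le0// /radw ltNge y0 mul0r.
rewrite /ebump /radw y0 mul0r subr0 -mulrA expRM_natl.
have -> : expR (2^-1 * ln y) = Num.sqrt y.
  by rewrite -powR12_sqrt ?ltW// /powR gt_eqF.
rewrite exprD -mul2n exprM sqr_sqrtr ?(ltW y0)// exprS; field.
by rewrite gt_eqF.
Qed.

End radial_weight.

Section integrable_real_functions.
Context d (T : measurableType d) (R : realType) (mu : {measure set T -> \bar R}).
Implicit Types f h : T -> R.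

Lemma integrable_realD f h : mu.-integrable setT (EFin \o f) ->
  mu.-integrable setT (EFin \o h) -> mu.-integrable setT (EFin \o (fun x => f x + h x)).
Proof. by move=> fi hi; have := integrableD measurableT fi hi. Qed.

Lemma integrable_realZ c f : mu.-integrable setT (EFin \o f) ->
  mu.-integrable setT (EFin \o (fun x => c * f x)).
Proof. by move=> fi; have := integrableZl measurableT c fi. Qed.

Lemma integrable_real_sum I (s : seq I) (f : I -> T -> R) :
  (forall i, mu.-integrable setT (EFin \o f i)) ->
  mu.-integrable setT (EFin \o (fun x => \sum_(i <- s) f i x)).
Proof.
move=> fi; rewrite (_ : EFin \o _ = (fun x => \sum_(i <- s) (EFin \o f i) x)%E).
  by apply: integrable_sum => // i _; exact: fi.
by apply/funext => x /=; rewrite sumEFin.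
Qed.

End integrable_real_functions.

Section conditional_risk.
Context {R : realType} {p k : nat}.
Hypotheses (hk : (0 < k)%N) (hp : (0 < p)%N).
Local Notation mu := (@lebesgue_rV R p).
Variables (g : 'rV[R]_p -> 'rV[R]_p) (gamma divg divgg lapg : 'rV[R]_p -> R).
Hypothesis gamma_ge0 : forall t, 0 <= gamma t.
Hypothesis hdivg : is_weak_div g divg.
Hypothesis hdivgg : is_weak_div (fun t => gamma t *: g t) divgg.
Hypothesis hlapg : is_weak_laplacian gamma lapg.

Let ineq t := gamma t ^+ 2 - 4 / (k + 2)%:R * (gamma t * divg t)
     + 4 / (k + 6)%:R * divgg t
     + 2 / ((k + 4)%:R * (k + 6)%:R) * lapg t.
Hypothesis hineq : {ae lebesgue_rV p, forall t, ineq t <= 0}.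

Variables (r : R) (theta : 'rV[R]_p).
Hypothesis r0 : 0 < r.
Local Notation s := (sqgap r theta).

(* The error delta0 - loss, as a function of x and t = |u|^2. *)
Definition err0 (x : 'rV[R]_p) (t : R) : R :=
  p%:R / k%:R * t + (sqnormv (g x) + 2 / (k + 2)%:R * divg x) * t ^+ 2 -
  sqnormv (x + t *: g x - theta).

Definition err1 (x : 'rV[R]_p) (t : R) : R := err0 x t - t ^+ 2 * gamma x.

(** The exponent of [w * s ^+ 4]. It gives [2a = k + 6] in the gradient of [phi] and
    [4a(a - 1) = (k + 4)(k + 6)] in its Laplacian, the denominators of the differential
    inequality. *)
Let a : R := (k + 6)%:R / 2.
Let a2 : 2 <= a.
Proof. by rewrite /a ler_pdivlMr// -natrM ler_nat; rewrite mulnE /= addnC. Qed.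

Let phi x := ebump 0 a (s x).
Let phi1 x := ebump 0 (a - 1) (s x).
Let phi2 x := ebump 0 (a - 2) (s x).
Let w x := radw k (s x).

Let phiE x : phi x = w x * s x ^+ 4.
Proof. by rewrite /phi /a (ebump_radw k 3). Qed.

Let phi1E x : phi1 x = w x * s x ^+ 3.
Proof.
rewrite /phi1 (_ : a - 1 = (k + 2.*2)%:R / 2) ?ebump_radw//.
by rewrite /a (_ : 2.*2 = 4)%N// !natrD; field.
Qed.

Let phi2E x : phi2 x = w x * s x ^+ 2.
Proof.
rewrite /phi2 (_ : a - 2 = (k + 1.*2)%:R / 2) ?ebump_radw//.
by rewrite /a (_ : 1.*2 = 2)%N// !natrD; field.
Qed.

Let lgamma : locally_integrable_rV gamma.
Proof.
have [F gF _] := hlapg; have i : 'I_p := Ordinal hp.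
by have [] := gF i.
Qed.

Let mgamma : measurable_fun setT gamma. Proof. by have [] := lgamma. Qed.

Let mg : measurable_fun setT g.
Proof. by apply: measurable_fun_rVP => i; have [/(_ i)[]] := hdivg. Qed.

Let mdivg : measurable_fun setT divg. Proof. by have [_ []] := hdivg. Qed.

Let ms : measurable_fun setT s. Proof. exact: measurable_sqgap. Qed.
Let mw : measurable_fun setT w. Proof. exact: (measurableT_comp (measurable_radw k)). Qed.

Lemma measurable_err0 d (T : measurableType d) (X : T -> 'rV[R]_p) (t : T -> R) :
  measurable_fun setT X -> measurable_fun setT t ->
  measurable_fun setT (fun z => err0 (X z) (t z)).
Proof.
move=> mX mt; rewrite /err0.
have mgX := measurableT_comp mg mX; have mdX := measurableT_comp mdivg mX.
apply: measurable_funB.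
  apply: measurable_funD; first exact: measurable_funM.
  apply: measurable_funM; last exact: measurable_funX.
  apply: measurable_funD; last exact: measurable_funM.
  exact: (measurableT_comp (@measurable_sqnormv R p)).
apply: (measurableT_comp (@measurable_sqnormv R p)).
apply: measurable_rVD => //; apply: measurable_rVD => //; exact: measurable_rVZ.
Qed.

Lemma measurable_err1 d (T : measurableType d) (X : T -> 'rV[R]_p) (t : T -> R) :
  measurable_fun setT X -> measurable_fun setT t ->
  measurable_fun setT (fun z => err1 (X z) (t z)).
Proof.
move=> mX mt; apply: measurable_funB; first exact: measurable_err0.
by apply: measurable_funM; [exact: measurable_funX|exact: measurableT_comp].
Qed.

Let igphi1 : mu.-integrable setT (EFin \o (fun x => gamma x * phi1 x)).
Proof.
have i : 'I_p := Ordinal hp.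
have [K [cK mK K0]] := sqgap_support theta r0.
have a10 : 0 <= a - 1 by rewrite subr_ge0 (le_trans _ a2)// ler1n.
apply: (locally_integrableM lgamma cK mK (C := ebump 0 (a - 1) (r ^+ 2))).
- exact: (measurableT_comp (measurable_bump 0 _)).
- move=> x; rewrite ger0_norm ?bump_ge0// bump0_le ?exprn_gt0//.
  exact: sqgap_le_sqr.
- by move=> x /K0 sx; rewrite /phi1 bump_le0.
Qed.

(* phi is w s^4, the weight of |u|^8.  The terms of Z other than the last
   integrate to 0 by parts; the last one is what remains because the coefficient
   of |u|^2 in delta0 is p / k instead of p / (k + 4). *)
Let kappa : R := 2 * p%:R * (k%:R^-1 - (k + 4)%:R^-1).

Let kappa_gt0 : 0 < kappa.
Proof.
rewrite mulr_gt0 ?mulr_gt0 ?ltr0n ?hp// subr_gt0 ltf_pV2 ?posrE ?ltr0n ?addn_gt0 ?hk//.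
by rewrite ltr_nat -[ltnLHS]addn0 ltn_add2l.
Qed.

Let F t := gamma t *: g t.
(** [S1] is [F . grad phi] and [S2] is [gamma * Lap phi], kept as sums over coordinates to match the
    integrations by parts. *)
Let S1 x := \sum_i (F x 0 i * (- 2 * a * phi1 x * (x 0 i - theta 0 i))).
Let S2 x := \sum_i (gamma x *
  (4 * a * (a - 1) * phi2 x * (x 0 i - theta 0 i) ^+ 2 - 2 * a * phi1 x)).
Let Z x := - (4 / (k + 6)%:R) * (S1 x + divgg x * phi x) +
  2 / ((k + 4)%:R * (k + 6)%:R) * (S2 x + - 1 * (lapg x * phi x)) +
  - kappa * (gamma x * phi1 x).

Let iF i : mu.-integrable setT (EFin \o
  (fun x => F x 0 i * (- 2 * a * phi1 x * (x 0 i - theta 0 i)))).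
Proof. by apply: integrable_bump_grad => //; have [] := hdivgg. Qed.

Let iS2 i : mu.-integrable setT (EFin \o (fun x => gamma x *
  (4 * a * (a - 1) * phi2 x * (x 0 i - theta 0 i) ^+ 2 - 2 * a * phi1 x))).
Proof. exact: integrable_bump_hess. Qed.

Let idivgg : mu.-integrable setT (EFin \o (fun x => divgg x * phi x)).
Proof. by apply: integrable_bump => //; have [] := hdivgg. Qed.

Let ilapg : mu.-integrable setT (EFin \o (fun x => lapg x * phi x)).
Proof. by apply: integrable_bump => //; have [G _ []] := hlapg. Qed.

Let iZ1 : mu.-integrable setT (EFin \o (fun x => S1 x + divgg x * phi x)).
Proof. by apply: integrable_realD => //; exact: integrable_real_sum. Qed.

Let iZ2 : mu.-integrable setT (EFin \o (fun x => S2 x + - 1 * (lapg x * phi x))).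
Proof.
by apply: integrable_realD; [exact: integrable_real_sum|exact: integrable_realZ].
Qed.

Let iZ : mu.-integrable setT (EFin \o Z).
Proof.
apply: integrable_realD; last exact: integrable_realZ.
by apply: integrable_realD; exact: integrable_realZ.
Qed.

Let integral_Z : \int[mu]_x Z x = - kappa * \int[mu]_x (gamma x * phi1 x).
Proof.
have I1 : \int[mu]_x (S1 x + divgg x * phi x) = 0.
  rewrite RintegralD//; last exact: integrable_real_sum.
  by rewrite Rintegral_sum// (@weak_div_bump R p r a theta r0 a2 _ _ hdivgg) addNr.
have I2 : \int[mu]_x (S2 x + - 1 * (lapg x * phi x)) = 0.
  rewrite RintegralD//; [|exact: integrable_real_sum|exact: integrable_realZ].
  by rewrite Rintegral_sum// (@weak_laplacian_bump R p r a theta r0 a2 _ _ hlapg) RintegralZl// mulN1r subrr.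
rewrite RintegralD//; [|by apply: integrable_realD; exact: integrable_realZ|exact: integrable_realZ].
rewrite RintegralD//; [|exact: integrable_realZ|exact: integrable_realZ].
by rewrite !RintegralZl// I1 I2 !mulr0 !add0r.
Qed.

Let sqnormv_loss (x : 'rV[R]_p) (t : R) : sqnormv (x + t *: g x - theta) =
  sqnormv (x - theta) + 2 * t * dotv (g x) (x - theta) + t ^+ 2 * sqnormv (g x).
Proof.
rewrite /sqnormv /dotv !mulr_sumr -!big_split/=; apply: eq_bigr => i _.
by rewrite !mxE; ring.
Qed.

Let S1E x : S1 x = - 2 * a * phi1 x * gamma x * dotv (g x) (x - theta).
Proof.
rewrite /S1 /dotv mulr_sumr; apply: eq_bigr => i _.
by rewrite !mxE; ring.
Qed.

Let S2E x : S2 x = gamma x *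
  (4 * a * (a - 1) * phi2 x * sqnormv (x - theta) - p%:R * (2 * a * phi1 x)).
Proof.
rewrite /S2 -mulr_sumr; congr (_ * _).
rewrite sumrB sumr_const card_ord -[X in _ - X]mulr_natl; congr (_ - _).
by rewrite /sqnormv /dotv mulr_sumr; apply: eq_bigr => i _; rewrite !mxE; ring.
Qed.

(** The change in the squared error is [s^4 gamma^2 - 2 s^2 gamma err0]. In it [g . (x - theta)]
    comes from [S1] and [|x - theta|^2] from [S2]; the second term of [Lap phi] accounts for
    [p / (k + 4)] out of [p / k], leaving [kappa]. The terms in [divgg] and [lapg] cancel between
    [Z] and [ineq], so the identity holds at every point. *)
Let risk_identity x :
  w x * err1 x (s x) ^+ 2 = w x * err0 x (s x) ^+ 2 + Z x + phi x * ineq x.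
Proof.
rewrite /err1 /err0 /Z S1E S2E /ineq /kappa phiE phi1E phi2E sqnormv_loss /a !natrD.
have k0 : k%:R != 0 :> R by rewrite pnatr_eq0 -lt0n.
have kn n : (0 < n)%N -> k%:R + n%:R != 0 :> R.
  by move=> n0; rewrite -natrD pnatr_eq0 addn_eq0 negb_and -!lt0n n0 orbT.
by field; rewrite k0 !kn.
Qed.

Lemma conditional_risk_bound :
  (\int[mu]_x ((w x)%:E * ((err0 x (s x)) ^+ 2)%:E) < +oo ->
  \int[mu]_x ((w x)%:E * ((err1 x (s x)) ^+ 2)%:E) <=
  \int[mu]_x ((w x)%:E * ((err0 x (s x)) ^+ 2)%:E) -
  (kappa * Rintegral mu setT (fun x => gamma x * phi1 x)%R)%:E)%E.
Proof.
move=> finE0.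
have w0 x : 0 <= w x by exact: radw_ge0.
have mE0 : measurable_fun setT (fun x => w x * err0 x (s x) ^+ 2).
  by apply: measurable_funM => //; apply: measurable_funX; exact: measurable_err0.
have mE1 : measurable_fun setT (fun x => w x * err1 x (s x) ^+ 2).
  by apply: measurable_funM => //; apply: measurable_funX; exact: measurable_err1.
have iE0 : mu.-integrable setT (EFin \o (fun x => w x * err0 x (s x) ^+ 2)).
  apply/integrableP; split; first exact/measurable_EFinP.
  under eq_integral => x _.
    rewrite /= ger0_norm; last by rewrite mulr_ge0// sqr_ge0.
    rewrite EFinM; over.
  exact: finE0.
have iEZ : mu.-integrable setT (EFin \o (fun x => w x * err0 x (s x) ^+ 2 + Z x)).
  exact: integrable_realD.
have mEZ : measurable_fun setT (fun x => w x * err0 x (s x) ^+ 2 + Z x).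
  by apply/measurable_EFinP; case/integrableP : iEZ.
have aeZ : {ae mu, forall x, w x * err1 x (s x) ^+ 2 <= w x * err0 x (s x) ^+ 2 + Z x}.
  apply: filterS hineq => x ix; rewrite risk_identity gerDl.
  by rewrite mulr_ge0_le0// bump_ge0.
(* The upper bound is nonnegative only almost everywhere, so it is truncated at 0 to compare
   integrals of nonnegative functions; the truncation is then removed almost everywhere. *)
apply: (@le_trans _ _ (\int[mu]_x (Num.max (w x * err0 x (s x) ^+ 2 + Z x) 0)%:E)%E).
  apply: ae_ge0_le_integral => //.
  - by move=> x _; rewrite -EFinM lee_fin mulr_ge0// sqr_ge0.
  - by under eq_fun do rewrite -EFinM; exact/measurable_EFinP.
  - by move=> x _; rewrite lee_fin le_max lexx orbT.
  - by apply/measurable_EFinP; exact: measurable_maxr.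
  apply: filterS aeZ => x zx _.
  by rewrite -EFinM lee_fin le_max zx.
rewrite (ae_eq_integral (EFin \o (fun x => w x * err0 x (s x) ^+ 2 + Z x)))//; last 3 first.
- by apply/measurable_EFinP; exact: measurable_maxr.
- exact/measurable_EFinP.
- apply: filterS aeZ => x zx _ /=; congr EFin; apply/max_idPl.
  by apply: le_trans zx; rewrite mulr_ge0// sqr_ge0.
rewrite (@integralD _ _ _ _ _ measurableT (EFin \o (fun x => w x * err0 x (s x) ^+ 2)) (EFin \o Z))//.
apply: leeD; first by rewrite le_eqVlt; apply/orP; left; apply/eqP; apply: eq_integral => x _; rewrite /= EFinM.
rewrite -[leLHS]fineK; last exact: integrable_fin_num.
have -> : fine (\int[mu]_x (EFin \o Z) x)%E = \int[mu]_x Z x by [].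
by rewrite integral_Z mulNr EFinN.
Qed.

Let igphi1_fin : (\int[mu]_x (gamma x * phi1 x)%:E < +oo)%E.
Proof.
have /integrableP[_] := igphi1; under eq_integral => x _.
  rewrite /= ger0_norm; last by rewrite mulr_ge0// bump_ge0.
  over.
by [].
Qed.

Lemma conditional_risk_le :
  (\int[mu]_x ((w x)%:E * ((err1 x (s x)) ^+ 2)%:E) <=
  \int[mu]_x ((w x)%:E * ((err0 x (s x)) ^+ 2)%:E))%E.
Proof.
have [finE0|] := ltP (\int[mu]_x ((w x)%:E * ((err0 x (s x)) ^+ 2)%:E))%E +oo%E; last first.
  by rewrite leye_eq => /eqP ->; exact: leey.
apply: (le_trans (conditional_risk_bound finE0)).
rewrite geeDl// leeNl oppe0 lee_fin mulr_ge0//; first exact: ltW.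
by apply: Rintegral_ge0 => x _; rewrite mulr_ge0// bump_ge0.
Qed.

(** The indicator marks the points where the two estimators differ. If the gain were 0, then
    [gamma * w * s^3] would vanish almost everywhere, and so would [w] times this indicator. *)
Lemma conditional_risk_lt :
  (\int[mu]_x ((w x)%:E * ((err0 x (s x)) ^+ 2)%:E) < +oo ->
  0 < \int[mu]_x ((w x)%:E * (if s x ^+ 2 * gamma x != 0 then 1 else 0)%:E) ->
  \int[mu]_x ((w x)%:E * ((err1 x (s x)) ^+ 2)%:E) <
  \int[mu]_x ((w x)%:E * ((err0 x (s x)) ^+ 2)%:E))%E.
Proof.
move=> finE0 pos.
apply: (le_lt_trans (conditional_risk_bound finE0)).
have E00 : (0 <= \int[mu]_x ((w x)%:E * ((err0 x (s x)) ^+ 2)%:E))%E.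
  by apply: integral_ge0 => x _; rewrite -EFinM lee_fin mulr_ge0 ?radw_ge0 ?sqr_ge0.
rewrite lteBlDr// lteDl ?ge0_fin_numE// lte_fin mulr_gt0//.
have I0 : (0 <= \int[mu]_x (gamma x * phi1 x)%:E)%E.
  by apply: integral_ge0 => x _; rewrite lee_fin mulr_ge0// bump_ge0.
rewrite /Rintegral fine_gt0// igphi1_fin andbT lt0e I0 andbT.
apply: contraTneq pos => Z0; rewrite -leNgt.
have mgp : measurable_fun setT (fun x => (gamma x * phi1 x)%:E).
  by case/integrableP : igphi1.
have : (\int[mu]_x `|(gamma x * phi1 x)%:E|)%E = 0%E.
  rewrite -[RHS]Z0; apply: eq_integral => x _.
  by rewrite gee0_abs// lee_fin mulr_ge0// bump_ge0.
move/(ae_eq_integral_abs mu measurableT mgp) => gp0.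
rewrite (ae_eq_integral (cst 0%E))//; last 2 first.
- apply: emeasurable_funM; first exact/measurable_EFinP.
  apply/measurable_EFinP; apply: measurable_fun_ifT => //.
  apply: (measurable_neg (f := fun x => s x ^+ 2 * gamma x == 0)).
  apply: measurable_fun_eqr => //; apply: measurable_funM => //.
  exact: measurable_funX.
- apply: filterS gp0 => x /(_ I) /= [gp] _; rewrite -EFinM; congr EFin.
  case: ifPn => [|_]; last by rewrite mulr0.
  rewrite mulf_eq0 negb_or sqrf_eq0 => /andP[sx0 gx0].
  move/eqP : gp; rewrite phi1E mulf_eq0 (negbTE gx0)/= mulf_eq0 expf_eq0 (negbTE sx0)/= orbF.
  by move=> /eqP ->; rewrite mul0r.
by rewrite integral0.
Qed.

End conditional_risk.

(** * Integration over the radius *)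

Section ae_equality.
Local Open Scope ereal_scope.
Context d (T : measurableType d) (R : realType) (mu : {measure set T -> \bar R}).

(** [h - f] is nonnegative with integral 0. Integrability first makes both functions finite almost
    everywhere, so that the subtraction is meaningful. *)
Lemma ge0_le_integral_eq_ae (f h : T -> \bar R) :
  measurable_fun setT f -> measurable_fun setT h ->
  (forall x, 0 <= f x) -> (forall x, f x <= h x) ->
  \int[mu]_x h x < +oo -> \int[mu]_x h x <= \int[mu]_x f x ->
  {ae mu, forall x, h x < +oo /\ f x = h x}.
Proof.
move=> mf mh f0 fh hy hf.
have h0 x : 0 <= h x by exact: le_trans (fh x).
have ih : mu.-integrable setT h.
  apply/integrableP; split => //.
  by under eq_integral => x _ do rewrite gee0_abs//.
have if_ : mu.-integrable setT f.
  by apply: (le_integrable _ _ _ ih) => // x _; rewrite !gee0_abs.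
have aeh := integrable_ae measurableT ih.
have aef := integrable_ae measurableT if_.
have mhf : measurable_fun setT (fun x => h x - f x) by exact: emeasurable_funB.
have : \int[mu]_x `|h x - f x| = 0.
  transitivity (\int[mu]_x (h x - f x)).
    apply: ae_eq_integral => //; first exact: measurableT_comp.
    apply: filterS2 aeh aef => x /(_ I) hx /(_ I) fx _.
    by rewrite gee0_abs// sube_ge0 ?fx.
  rewrite integralB// (_ : \int[mu]_x h x = \int[mu]_x f x) ?subee//.
    exact: integrable_fin_num.
  apply/eqP; rewrite eq_le hf/=; exact: ge0_le_integral.
move/(ae_eq_integral_abs mu measurableT mhf) => hf0.
apply: filterS3 hf0 aeh aef => x /(_ I) /= hfx /(_ I) hx /(_ I) fx.
split; first by rewrite -ge0_fin_numE.
by move: hfx; rewrite -(fineK hx) -(fineK fx) -EFinB => -[/eqP]; rewrite subr_eq0 => /eqP ->.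
Qed.

End ae_equality.

Section spherical_integral.
Local Open Scope ereal_scope.
Context {R : realType} {p k : nat}.
Context d d' (T : measurableType d) (Om : measurableType d').
Variables (P : probability T R) (Q : probability Om R).
Variables (X : {mfun T >-> 'rV[R]_p}) (U : {mfun T >-> 'rV[R]_k}).
Variables (Rad : {mfun Om >-> R}) (V : {mfun Om >-> 'rV[R]_(p + k)}).

(** Independence gives the joint law on rectangles, hence identifies it with the product of the two
    laws, to which Tonelli applies. *)
Lemma independent_integral n (W : {mfun Om >-> 'rV[R]_n}) (H : R * 'rV[R]_n -> \bar R) :
  independent_RV Q Rad W -> measurable_fun setT H -> (forall z, 0 <= H z) ->
  \int[Q]_w H (Rad w, W w) = \int[Q]_w1 \int[Q]_w2 H (Rad w1, W w2).
Proof.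
move=> ind mH H0.
have mRW : measurable_fun setT (fun w => (Rad w, W w)) by exact: measurable_fun_pair.
transitivity (\int[distribution Q Rad \x distribution Q W]_z H z).
  apply/esym; apply: ge0_integral_image => // A mA.
  apply: (product_measure_unique (m' := image_measure Q mRW)) => //.
rewrite fubini_tonelli1//.
rewrite ge0_integral_distribution//; last first.
- by move=> x; exact: integral_ge0.
- exact: measurable_fun_fubini_tonelli_F.
apply: eq_integral => w _; rewrite /= /fubini_F ge0_integral_distribution//.
exact: (measurableT_comp mH (measurable_pair1 _)).
Qed.

Lemma spherical_integral (theta : 'rV[R]_p) (H : 'rV[R]_p * R -> \bar R) :
  spherically_symmetric P (fun w => row_mx (X w) (U w)) (row_mx theta 0) Q Rad V ->
  measurable_fun setT H -> (forall z, 0 <= H z) ->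
  \int[P]_w H (X w, sqnormv (U w)) = \int[Q]_w1 \int[Q]_w2
    H (theta + Rad w1 *: lsubmx (V w2), Rad w1 ^+ 2 * sqnormv (rsubmx (V w2)))%R.
Proof.
case=> Rad0 ind unifV law mH H0.
pose Hc (y : 'rV[R]_(p + k)) := H (lsubmx y, sqnormv (rsubmx y)).
have mHc : measurable_fun setT Hc.
  by apply: (measurableT_comp mH); mfun.
have Hc0 y : 0 <= Hc y by exact: H0.
have mXU : measurable_fun setT (fun w => row_mx (X w) (U w)).
  exact: (measurableT_comp (@measurable_row_mx R p k)
    (measurable_fun_pair (measurable_funPT X) (measurable_funPT U))).
have mRV : measurable_fun setT (fun z : R * 'rV[R]_(p + k) => row_mx theta 0 + z.1 *: z.2)%R.
  by mfun.
have mRVw : measurable_fun setT (fun w => row_mx theta 0 + Rad w *: V w)%R.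
  apply: measurable_rVD => //; exact: measurable_rVZ.
transitivity (\int[P]_w Hc (row_mx (X w) (U w))).
  by apply: eq_integral => w _; rewrite /Hc row_mxKl row_mxKr.
rewrite -(ge0_integral_image (nu := image_measure P mXU) mXU)//.
rewrite (ge0_integral_image (mu := Q) mRVw)//.
transitivity (\int[Q]_w1 \int[Q]_w2 Hc (row_mx theta 0 + Rad w1 *: V w2)%R).
  apply: (@independent_integral _ V (fun z => Hc (row_mx theta 0 + z.1 *: z.2)%R)) => //.
  exact: (measurableT_comp mHc mRV).
apply: eq_integral => w1 _; apply: eq_integral => w2 _; rewrite /Hc /=; congr H; congr pair.
  by rewrite linearD/= row_mxKl linearZ.
by rewrite linearD/= row_mxKr add0r linearZ/= sqnormvZ.
Qed.

End spherical_integral.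

(** For [gamma = 0] the two estimators coincide, so strictness is claimed once they differ with
    positive probability at some [theta] where the risk of [delta0] is finite. *)
Theorem theorem4p4 (R : realType) (p k : nat) (hk : (1 <= k)%N) (hp : (5 <= p)%N)
  (d : measure_display) (T : measurableType d)
  (P : 'rV[R]_p -> probability T R)
  (X : {mfun T >-> 'rV[R]_p}) (U : {mfun T >-> 'rV[R]_k})
  (d' : measure_display) (Om : measurableType d') (Q : probability Om R)
  (Rad : {mfun Om >-> R}) (V : {mfun Om >-> 'rV[R]_(p + k)})
  (hsph : forall theta : 'rV[R]_p,
     spherically_symmetric (P theta) (fun w => row_mx (X w) (U w))
       (row_mx theta 0) Q Rad V)
  (hmom : forall theta : 'rV[R]_p,
     ('E_(P theta)[fun w => (enorm (row_mx (X w) (U w)) ^+ 4)%R] < +oo)%E)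
  (g : 'rV[R]_p -> 'rV[R]_p) (hg : weakly_differentiable_field g)
  (hrisk : forall theta : 'rV[R]_p,
     ('E_(P theta)[loss X U (shrinkage g) theta] < +oo)%E)
  (gamma : 'rV[R]_p -> R) (hgamma0 : forall t, 0 <= gamma t)
  (hgamma : twice_weakly_differentiable gamma)
  (hbeta : exists beta : R, forall t, t != 0 -> gamma t <= beta / enorm t ^+ 2)
  (divg divgg lapg : 'rV[R]_p -> R)
  (hdivg : is_weak_div g divg)
  (hdivgg : is_weak_div (fun t => gamma t *: g t) divgg)
  (hlapg : is_weak_laplacian gamma lapg)
  (hineq : {ae lebesgue_rV p, forall t,
     gamma t ^+ 2 - 4 / (k + 2)%:R * (gamma t * divg t)
     + 4 / (k + 6)%:R * divgg t
     + 2 / ((k + 4)%:R * (k + 6)%:R) * lapg t <= 0}) :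
  (forall theta : 'rV[R]_p,
     (risk P X U (shrinkage g) (delta_corr g divg gamma) theta
      <= risk P X U (shrinkage g) (delta0 g divg) theta)%E) /\
  ((exists theta : 'rV[R]_p,
      (risk P X U (shrinkage g) (delta0 g divg) theta < +oo)%E /\
      (0 < P theta [set w | delta_corr g divg gamma (X w) (U w)
                            <> delta0 g divg (X w) (U w)])%E) ->
   dominates P X U (shrinkage g) (delta_corr g divg gamma) (delta0 g divg)).
Proof.
have p0 : (0 < p)%N by exact: leq_trans hp.
pose E0 theta (z : 'rV[R]_p * R) := ((err0 (k := k) g divg theta z.1 z.2) ^+ 2)%:E.
pose E1 theta (z : 'rV[R]_p * R) := ((err1 (k := k) g gamma divg theta z.1 z.2) ^+ 2)%:E.
(* The indicator of the event that the two estimators differ, as a function of [x] and [|u|^2]. *)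
pose N (z : 'rV[R]_p * R) : \bar R := (if z.2 ^+ 2 * gamma z.1 != 0 then 1 else 0)%:E.
have mgamma : measurable_fun setT gamma.
  have [G gG _] := hlapg; have i : 'I_p := Ordinal p0.
  by have [[]] := gG i.
have mE0 theta : measurable_fun setT (E0 theta).
  by apply/measurable_EFinP; apply: measurable_funX; exact: measurable_err0.
have mE1 theta : measurable_fun setT (E1 theta).
  apply/measurable_EFinP; apply: measurable_funX.
  by apply: (measurable_err1 p0 hdivg hlapg).
have mN : measurable_fun setT N.
  apply/measurable_EFinP; apply: measurable_fun_ifT => //.
  apply: (measurable_neg (f := fun z : 'rV[R]_p * R => z.2 ^+ 2 * gamma z.1 == 0)).
  apply: measurable_fun_eqr => //; apply: measurable_funM.
    exact: measurable_funX.
  exact: (measurableT_comp mgamma).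
have E00 theta z : (0 <= E0 theta z)%E by rewrite lee_fin sqr_ge0.
have E10 theta z : (0 <= E1 theta z)%E by rewrite lee_fin sqr_ge0.
have N0 z : (0 <= N z)%E by rewrite lee_fin; case: ifPn.
(* The conditional expectation of [H] given the radius [r]. *)
pose J (H : 'rV[R]_p * R -> \bar R) (theta : 'rV[R]_p) (r : R) : \bar R :=
  (\int[Q]_w H (theta + r *: lsubmx (V w), r ^+ 2 * sqnormv (rsubmx (V w)))%R)%E.
have J0 H theta r : (forall z, 0 <= H z)%E -> (0 <= J H theta r)%E.
  by move=> H0; exact: integral_ge0.
have mJ H theta : measurable_fun setT H -> (forall z, 0 <= H z)%E ->
    measurable_fun setT (fun w => J H theta (Rad w)).
  move=> mH H0.
  apply: (@ge0_measurable_integral _ _ _ _ _ Q (fun w1 w2 => H (theta + Rad w1 *: lsubmx (V w2),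
    Rad w1 ^+ 2 * sqnormv (rsubmx (V w2)))%R)) => //.
  have mR : measurable_fun setT (fun z : Om * Om => Rad z.1) by exact: measurableT_comp.
  have mV : measurable_fun setT (fun z : Om * Om => V z.2) by exact: measurableT_comp.
  by apply: (measurableT_comp mH); mfun.
have risk0E theta : risk P X U (shrinkage g) (delta0 g divg) theta =
    (\int[Q]_w J (E0 theta) theta (Rad w))%E.
  rewrite -(spherical_integral (hsph theta))//.
  by rewrite /risk unlock.
have risk1E theta : risk P X U (shrinkage g) (delta_corr g divg gamma) theta =
    (\int[Q]_w J (E1 theta) theta (Rad w))%E.
  rewrite -(spherical_integral (hsph theta))// /risk unlock.
  apply: eq_integral => w _; rewrite /E1 /err1; congr (_ ^+ 2)%:E.
  by rewrite /delta_corr addrAC.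
have sec theta r : 0 < r -> exists2 K : R, 0 < K & forall H, measurable_fun setT H ->
    (forall z, 0 <= H z)%E -> J H theta r = (K%:E * \int[lebesgue_rV p]_x
      ((radw k (sqgap r theta x))%:E * H (x, sqgap r theta x)))%E.
  by move=> r0; apply: sphere_section => //; have [] := hsph theta.
have Rad0 w : 0 <= Rad w by have [] := hsph 0.
have Jle theta r : 0 <= r -> (J (E1 theta) theta r <= J (E0 theta) theta r)%E.
  (* Radius 0 is outside the scope of [sphere_section], but there [|u|^2 = 0] and the two errors
     coincide. *)
  rewrite le_eqVlt => /predU1P[<-|r0].
    apply: ge0_le_integral => //.
    - by apply: (measurableT_comp (mE1 theta)); mfun.
    - by apply: (measurableT_comp (mE0 theta)); mfun.
    by move=> w _; rewrite /E1 /err1 /= expr0n/= mul0r expr0n/= mul0r subr0.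
  have [K K0 KE] := sec theta r r0; rewrite !KE//.
  apply: lee_wpmul2l; first by rewrite lee_fin ltW.
  exact: (conditional_risk_le hk p0 hgamma0 hdivg hdivgg hlapg hineq theta r0).
have Jlt theta r : 0 <= r -> (J (E0 theta) theta r < +oo)%E -> (0 < J N theta r)%E ->
    (J (E1 theta) theta r < J (E0 theta) theta r)%E.
  rewrite le_eqVlt => /predU1P[<- _|r0].
    rewrite /J integral0_eq ?ltxx// => w _.
    by rewrite /N /= !expr0n/= mul0r expr0n/= mul0r eqxx.
  have [K K0 KE] := sec theta r r0; rewrite !KE// => fin pos.
  have KE0 : (0 < K%:E)%E by rewrite lte_fin.
  rewrite lte_pmul2l//.
  apply: (conditional_risk_lt hk p0 hgamma0 hdivg hdivgg hlapg hineq r0).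
    move: fin; apply: contraTT; rewrite -!leNgt !leye_eq => /eqP ->.
    by rewrite gt0_muley.
  by move: pos; rewrite pmule_rgt0.
have riskle theta : (risk P X U (shrinkage g) (delta_corr g divg gamma) theta
      <= risk P X U (shrinkage g) (delta0 g divg) theta)%E.
  rewrite risk0E risk1E; apply: ge0_le_integral => //.
  - by move=> w _; exact: J0.
  - exact: mJ.
  - exact: mJ.
  - by move=> w _; exact: Jle.
split => // -[theta [fin pos]]; split => //; exists theta.
(* Otherwise the conditional risks, ordered at each radius, have equal finite integrals and agree
   for almost every radius. By [Jlt] the estimators then agree almost surely, contrary to [pos]. *)
rewrite ltNge; apply/negP => ge.
have ae := ge0_le_integral_eq_ae (mu := Q) (mJ _ theta (mE1 theta) (E10 theta))
  (mJ _ theta (mE0 theta) (E00 theta)) (fun w => J0 _ theta (Rad w) (E10 theta))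
  (fun w => Jle theta (Rad w) (Rad0 w)).
rewrite -risk0E -risk1E in ae.
have {}ae := ae fin ge.
move: pos; apply/negP; rewrite -leNgt.
have -> : P theta [set w | delta_corr g divg gamma (X w) (U w) <>
    delta0 g divg (X w) (U w)] = (\int[Q]_w J N theta (Rad w))%E.
  rewrite -(spherical_integral (hsph theta))//.
  pose S := [set w : T | sqnormv (U w) ^+ 2 * gamma (X w) != 0].
  have mS : measurable S.
    have mf : measurable_fun setT (fun w => sqnormv (U w) ^+ 2 * gamma (X w) != 0).
      apply: (measurable_neg (f := fun w => sqnormv (U w) ^+ 2 * gamma (X w) == 0)).
      apply: measurable_fun_eqr => //; apply: measurable_funM.
        apply: measurable_funX; exact: (measurableT_comp (@measurable_sqnormv R k)).
      exact: (measurableT_comp mgamma).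
    by rewrite -[S]setTI; exact: (mf measurableT [set true]).
  rewrite (_ : [set w | _] = S); last first.
    apply/seteqP; split => w; rewrite /S/= /delta_corr.
      by move=> h; apply/eqP => h0; apply: h; rewrite h0 subr0.
    by move=> h0 /eqP; rewrite -subr_eq0 addrAC subrr add0r oppr_eq0 (negbTE h0).
  rewrite -[S in LHS]setIT -integral_indic//.
  apply: eq_integral => w _; rewrite indicE /N/=; congr (_%:E).
  by case: ifPn => h; [rewrite mem_set|rewrite memNset//; exact/negP].
rewrite (ae_eq_integral (cst 0%E))//; last 2 first.
- exact: mJ.
- apply: filterS ae => w [h0y h10] _ /=; apply/eqP; rewrite eq_le J0// andbT leNgt.
  apply/negP => Npos; have := Jlt theta (Rad w) (Rad0 w) h0y Npos.
  by rewrite h10 ltxx.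
by rewrite integral0.
Qed.
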